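(* Let $\phi\colon (M,g)\to (N,h)$ be a smooth harmonic map between Riemannian manifolds. Then $\phi$ is a weakly stable critical point of the ES-4-curvature energy $$\hat E_4(\phi)=\frac14\int_M\sum_{i,j}|R^N(d\phi(e_i),d\phi(e_j))\tau(\phi)|^2\,dv_g .$$
   Context: $\bar\nabla$ is the connection on $\phi^\ast TN$, $\tau(\phi)=\operatorname{Tr}_g\bar\nabla d\phi$ is the tension field; $\phi$ is harmonic if $\tau(\phi)=0$. $\{e_i\}$ is a local orthonormal frame of $TM$ and $R^N(X,Y)Z=\nabla_X\nabla_YZ-\nabla_Y\nabla_XZ-\nabla_{[X,Y]}Z$. A critical point $\phi$ of $\hat E_4$ is called weakly stable if $\frac{d^2}{dt^2}\big|_{t=0}\hat E_4(\phi_t)\ge0$ for every $V\in\Gamma(\phi^\ast TN)$, $V\neq0$, and every smooth variation $\phi_t$ of $\phi=\phi_0$ with $\partial_t\phi_t|_{t=0}=V$. Variations are taken with compact support (automatic if $M$ is closed). *)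

(* Defs.v *)
From HB Require Import structures.
From mathcomp Require Import all_boot all_order all_algebra.
From mathcomp Require Import all_classical all_reals all_analysis.

Set Implicit Arguments.
Unset Strict Implicit.
Unset Printing Implicit Defensive.
Import Order.TTheory GRing.Theory Num.Theory.
Import numFieldNormedType.Exports.

Local Open Scope classical_set_scope.
Local Open Scope ring_scope.

(* The coordinate space R^n is 'rV[R]_n.  A bilinear form with matrix G sends  *)
(* (u, v) to u G v^T, and ('d f y) v = v *m jacobian f y.                      *)

(* On an open set U of a finite-dimensional space this is the usual C^k. *)
Fixpoint Ck (R : realType) (V W : normedModType R) (k : nat) (U : set V)
    (f : V -> W) : Prop :=
  match k with
  | 0 => forall x, U x -> {for x, continuous f}
  | k'.+1 => (forall x, U x -> differentiable f x) /\
             (forall v, Ck k' U ('D_v f))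
  end.

Definition smooth_on (R : realType) (V W : normedModType R) (U : set V)
  (f : V -> W) : Prop := forall k, Ck k U f.

(* Lebesgue integral over R^n of a nonnegative Borel function, as an iterated *)
(* integral (Tonelli).                                                        *)
Fixpoint rV_integral (R : realType) (n : nat) :
    ('rV[R]_n -> \bar R) -> \bar R :=
  match n return ('rV[R]_n -> \bar R) -> \bar R with
  | 0 => fun f => f 0
  | n'.+1 => fun f =>
      (\int[lebesgue_measure]_(x in [set: R])
         rV_integral (fun v : 'rV[R]_n' =>
           f (row_mx (x%:M : 'rV[R]_1) v : 'rV[R]_n'.+1)))%E
  end.

(* [chart_map i] and [param i] are total functions, meaningful only on [dom i] *)
(* and on its image.  The choice [chart_at p] of a chart around each p is part *)
(* of the structure so that tangent vectors at p can be written in coordinates.*)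
Record smoothManifold (R : realType) (n : nat) := SmoothManifold {
  carrier :> ptopologicalType ;
  manifold_hausdorff : hausdorff_space carrier ;
  manifold_second_countable : @second_countable carrier ;
  atlas : Type ;
  dom : atlas -> set carrier ;
  chart_map : atlas -> carrier -> 'rV[R]_n ;
  param : atlas -> 'rV[R]_n -> carrier ;
  chart_at : carrier -> atlas ;
  dom_chart_at : forall p, dom (chart_at p) p ;
  open_dom : forall i, open (dom i) ;
  open_chart_map_dom : forall i, open (chart_map i @` dom i) ;
  chart_mapK : forall i p, dom i p -> param i (chart_map i p) = p ;
  chart_map_continuous_on : forall i p, dom i p ->
    {for p, continuous (chart_map i)} ;
  param_continuous_on : forall i y, (chart_map i @` dom i) y ->
    {for y, continuous (param i)} ;
  transition_smooth : forall i j,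
    smooth_on (chart_map i @` (dom i `&` dom j)) (chart_map j \o param i) }.

Definition inner (R : realType) (n : nat) (G : 'M[R]_n) (u v : 'rV[R]_n) : R :=
  (u *m G *m v^T) 0 0.

(* [metric_mx g i y] is the matrix of the components g_ab in the chart i at *)
(* the point with coordinates y.                                            *)
Record riemannianMetric (R : realType) (n : nat) (M : smoothManifold R n) :=
  RiemannianMetric {
  metric_mx :> atlas M -> 'rV[R]_n -> 'M[R]_n ;
  metric_smooth : forall i a b,
    smooth_on (chart_map i @` dom i) (fun y => metric_mx i y a b) ;
  metric_sym : forall i y, (chart_map i @` dom i) y ->
    (metric_mx i y)^T = metric_mx i y ;
  metric_pos : forall i y, (chart_map i @` dom i) y ->
    forall v, v != 0 -> 0 < inner (metric_mx i y) v v ;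
  metric_transition : forall i j y, (chart_map i @` (dom i `&` dom j)) y ->
    let J := jacobian (chart_map j \o param i) y in
    metric_mx i y = J *m metric_mx j (chart_map j (param i y)) *m J^T }.

Notation borel T := (g_sigma_algebraType (@open T)).

(* The defining property of dv_g = sqrt(det g_ab) dx^1 ... dx^n; by second *)
(* countability it holds for at most one Borel measure.                    *)
Definition riemannian_measure (R : realType) (n : nat) (M : smoothManifold R n)
    (g : riemannianMetric M) (mu : {measure set (borel M) -> \bar R}) : Prop :=
  forall (i : atlas M) (A : set (borel M)), measurable A -> A `<=` @dom _ _ M i ->
    mu A = rV_integral
      (fun y => (Num.sqrt (\det (g i y)) * \1_(chart_map i @` A) y)%:E).

Section coordinate_connection.
Context (R : realType) (n : nat).
Variable G : 'rV[R]_n -> 'M[R]_n.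
Implicit Types (X Y Z : 'rV[R]_n -> 'rV[R]_n).

Definition partial (a : 'I_n) (f : 'rV[R]_n -> R) : 'rV[R]_n -> R :=
  'D_(delta_mx 0 a) f.

(* Gamma^c_ab of the Levi-Civita connection of G. *)
Definition christoffel (y : 'rV[R]_n) (a b c : 'I_n) : R :=
  2^-1 * \sum_d invmx (G y) c d *
    (partial a (fun z => G z b d) y + partial b (fun z => G z a d) y
     - partial d (fun z => G z a b) y).

Definition christoffel_map (y u v : 'rV[R]_n) : 'rV[R]_n :=
  \row_c \sum_a \sum_b christoffel y a b c * u 0 a * v 0 b.

Definition levi_civita X Y : 'rV[R]_n -> 'rV[R]_n :=
  fun y => 'D_(X y) Y y + christoffel_map y (X y) (Y y).

Definition lie_bracket X Y : 'rV[R]_n -> 'rV[R]_n :=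
  fun y => 'D_(X y) Y y - 'D_(Y y) X y.

Definition curvature X Y Z : 'rV[R]_n -> 'rV[R]_n := fun y =>
  levi_civita X (levi_civita Y Z) y - levi_civita Y (levi_civita X Z) y
  - levi_civita (lie_bracket X Y) Z y.

(* R is tensorial: its value on tangent vectors at y may be computed on any *)
(* extensions, here the ones with constant components.                      *)
Definition curvature_at (y u v w : 'rV[R]_n) : 'rV[R]_n :=
  curvature (fun=> u) (fun=> v) (fun=> w) y.

End coordinate_connection.

(* The rows of [frame G] are an orthonormal basis of (R^m, G); one exists when *)
(* G is symmetric positive definite, and the traces below do not depend on it. *)
Definition frame (R : realType) (m : nat) (G : 'M[R]_m) : 'M[R]_m :=
  xget 1%:M [set E | E *m G *m E^T = 1%:M].

(* G and H are the metrics of source and target in charts, f is a map read in *)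
(* these charts.                                                              *)
Section coordinate_tension.
Context (R : realType) (m n : nat).
Variables (G : 'rV[R]_m -> 'M[R]_m) (H : 'rV[R]_n -> 'M[R]_n).
Variable f : 'rV[R]_m -> 'rV[R]_n.

(* The connection on the pull-back of the tangent bundle of the target. *)
Definition pullback_connection (X : 'rV[R]_m -> 'rV[R]_m)
    (V : 'rV[R]_m -> 'rV[R]_n) : 'rV[R]_m -> 'rV[R]_n :=
  fun y => 'D_(X y) V y + christoffel_map H (f y) ('D_(X y) f y) (V y).

(* (nabla_X df)(Y) = nabla_X (df(Y)) - df(nabla_X Y) *)
Definition second_fundamental_form (X Y : 'rV[R]_m -> 'rV[R]_m) :
    'rV[R]_m -> 'rV[R]_n :=
  fun y => pullback_connection X (fun z => 'D_(Y z) f z) y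
           - 'D_(levi_civita G X Y y) f y.

Definition tension (y : 'rV[R]_m) : 'rV[R]_n :=
  \sum_i second_fundamental_form (fun=> row i (frame (G y)))
                                 (fun=> row i (frame (G y))) y.

End coordinate_tension.

Section maps.
Context (R : realType) (m n : nat).
Variables (M : smoothManifold R m) (N : smoothManifold R n).
Variables (g : riemannianMetric M) (h : riemannianMetric N).

Definition smooth_map (phi : M -> N) : Prop :=
  continuous phi /\
  forall (i : atlas M) (j : atlas N),
    smooth_on ((chart_map i @` dom i) `&` [set y | dom j (phi (param i y))])
              (chart_map j \o phi \o param i).

(* From here on a tangent vector at a point is given by its components in the *)
(* chart [chart_at] of that point.                                            *)

Definition local_rep (phi : M -> N) (p : M) : 'rV[R]_m -> 'rV[R]_n :=
  chart_map (chart_at (phi p)) \o phi \o param (chart_at p).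

Definition differential (phi : M -> N) (p : M) (v : 'rV[R]_m) : 'rV[R]_n :=
  'D_v (local_rep phi p) (chart_map (chart_at p) p).

Definition tension_field (phi : M -> N) (p : M) : 'rV[R]_n :=
  tension (g (chart_at p)) (h (chart_at (phi p))) (local_rep phi p)
          (chart_map (chart_at p) p).

Definition harmonic_map (phi : M -> N) : Prop :=
  forall p, tension_field phi p = 0.

Definition orthonormal_frame (p : M) (i : 'I_m) : 'rV[R]_m :=
  row i (frame (g (chart_at p) (chart_map (chart_at p) p))).

Definition metric_at (q : N) (u v : 'rV[R]_n) : R :=
  inner (h (chart_at q) (chart_map (chart_at q) q)) u v.

Definition curvature_tensor (q : N) (u v w : 'rV[R]_n) : 'rV[R]_n :=
  curvature_at (h (chart_at q)) (chart_map (chart_at q) q) u v w.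

Definition ES4_density (phi : M -> N) (p : M) : R :=
  \sum_i \sum_j
    let W := curvature_tensor (phi p)
               (differential phi p (orthonormal_frame p i))
               (differential phi p (orthonormal_frame p j))
               (tension_field phi p) in
    metric_at (phi p) W W.

(* A compactly supported variation Phi of phi, jointly smooth in (t, p) for t *)
(* near 0, with variation field V.  Smoothness of V follows from that of Phi. *)
Definition smooth_variation (phi : M -> N) (V : M -> 'rV[R]_n)
    (Phi : R -> M -> N) : Prop :=
  [/\ Phi 0 = phi,
      (forall p, V p =
         derive1 (fun t : R => chart_map (chart_at (phi p)) (Phi t p)) 0) &
      exists2 e : R, 0 < e &
      [/\ (forall (t : R) (p : M), `|t| < e ->
             {for (t, p), continuous (fun tp : R * M => Phi tp.1 tp.2)}),
          (forall (i : atlas M) (j : atlas N),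
             smooth_on [set ty : R * 'rV[R]_m | [/\ `|ty.1| < e,
                           (chart_map i @` dom i) ty.2 &
                           dom j (Phi ty.1 (param i ty.2))]]
                       (fun ty => chart_map j (Phi ty.1 (param i ty.2)))) &
          exists2 K : set M, compact K &
            forall (t : R) (p : M), `|t| < e -> ~ K p -> Phi t p = phi p]].

Variable vol : {measure set (borel M) -> \bar R}.

Definition ES4_energy (phi : M -> N) : \bar R :=
  ((4^-1)%:E * \int[vol]_(p in [set: borel M]) (ES4_density phi p)%:E)%E.

Definition energy_along (Phi : R -> M -> N) (t : R) : R :=
  fine (ES4_energy (Phi t)).

(* The finiteness clause makes [fine] harmless in [energy_along]. *)
Definition critical_point (phi : M -> N) : Prop :=
  forall (V : M -> 'rV[R]_n) (Phi : R -> M -> N), smooth_variation phi V Phi ->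
    (\forall t \near (0 : R), ES4_energy (Phi t) \is a fin_num) /\
    is_derive (0 : R) (1 : R) (energy_along Phi) (0 : R).

(* [derive1n] is total; the derivability clauses say that the second *)
(* derivative at 0 exists.                                           *)
Definition weakly_stable (phi : M -> N) : Prop :=
  critical_point phi /\
  forall (V : M -> 'rV[R]_n) (Phi : R -> M -> N),
    V <> (fun=> 0) -> smooth_variation phi V Phi ->
    [/\ (\forall t \near (0 : R), derivable (energy_along Phi) t 1),
        derivable (derive1 (energy_along Phi)) 0 1 &
        0 <= derive1n 2 (energy_along Phi) 0].

End maps.

(* Main.v *)
Require Import Defs.
From HB Require Import structures.
From mathcomp Require Import all_boot all_order all_algebra.
From mathcomp Require Import finmap.
From mathcomp Require Import all_classical all_reals all_analysis.
From mathcomp Require Import measurable_realfun.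
From mathcomp Require Import ring lra.

(** The tension field of a harmonic map vanishes, and with it the density
    |R(dphi, dphi) tau|^2.  Every energy is nonnegative, so along a variation
    [Phi] of [phi] the function t |-> E(Phi_t) has a minimum at t = 0, where its
    first derivative vanishes and its second derivative cannot be negative
    ([minimum_second_derivative]).  What has to be proved is that these
    derivatives exist.

    Off the compact support K of the variation [Phi t] agrees with [phi] near
    each point, so that the density is zero there ([tension_field_near],
    [ES4_density_eq0]).  Over K the density is, in charts, a smooth function of
    time and position ([Ck_coord_density]), and by compactness the density and
    its first two time derivatives have a common bound for small t
    ([regular_compact]).  As K has finite volume ([volume_compact]), the
    integral can be differentiated twice under the integral sign
    ([parametric_derive]).

    The density at p is expressed in the charts that are selected at p and at
    its image, and in an orthonormal basis that is selected at p.  These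
    selections need not be continuous in p.  Hence even the measurability of
    the density depends on its invariance ([ES4_density_chart]).  A trace over
    an orthonormal basis is rewritten with the inverse of the metric
    ([bilinear_trace]).  Under a change of coordinates the Christoffel symbols
    pick up the second derivatives of the change ([christoffel_change], which
    compares Koszul's formulas).  These derivatives are symmetric ([schwarz]),
    so they cancel in the curvature ([curvature_change]), and they compensate
    those of the map in its second fundamental form ([sff_change]).  The
    density is therefore a scalar ([coord_density_change]). *)

Set Implicit Arguments.
Unset Strict Implicit.
Unset Printing Implicit Defensive.
Import Order.TTheory GRing.Theory Num.Theory.
Import numFieldNormedType.Exports.

Local Open Scope classical_set_scope.
Local Open Scope ring_scope.

(** * Directional derivatives and C^k functions *)

Section differentiability.
Context (R : realType).
Implicit Types (V W : normedModType R).

Lemma differentiable_intro V W (f : V -> W) (df : {linear V -> W}) (x : V) :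
  continuous df ->
  (forall e : R, 0 < e ->
    \forall h \near (0 : V), `|f (h + x) - f x - df h| <= e * `|h|) ->
  differentiable f x /\ 'd f x = df :> (V -> W).
Proof.
move=> cdf fdf.
have fE : f \o shift x = cst (f x) + df +o_ (0 : V) id.
  apply/eqaddoP => e e0; near=> h.
  have -> : (f \o shift x - (cst (f x) + df)) h = f (h + x) - f x - df h.
    by rewrite !fctE /= opprD addrA.
  by near: h; exact: fdf.
have dE := diff_unique cdf fE.
by split => //; apply/diff_locallyP; rewrite dE; split.
Unshelve. all: by end_near. Qed.

Lemma near_eq_differentiable V W (f g : V -> W) (x : V) :
  (\forall z \near x, f z = g z) -> differentiable f x -> differentiable g x.
Proof.
move=> fg /[dup] dfx /diff_locallyP[cdf /eqaddoP fE].
have [] // := @differentiable_intro _ _ g ('d f x) x cdf.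
have fg0 : \forall h \near (0 : V), f (h + x) = g (h + x).
  by have := fg; rewrite (near_shift 0 x) subr0.
move=> e e0; apply: filterS2 fg0 (fE e e0) => h fgh.
by rewrite !fctE /= -fgh (nbhs_singleton fg) opprD addrA.
Qed.

Lemma differentiable_rowP V n (f : V -> 'rV[R]_n) (x : V) :
  differentiable f x <-> forall k, differentiable (fun z => f z 0 k) x.
Proof.
split=> [df k|df].
  have := @differentiable_comp _ _ _ _ f (fun N : 'rV[R]_n => N 0 k) x df.
  by apply; exact: differentiable_coord.
have -> : f = \sum_(k < n) (fun z => f z 0 k *: (delta_mx 0 k : 'rV[R]_n)).
  apply/funext => z; rewrite fct_sumE.
  by rewrite -row_sum_delta.
by apply: differentiable_sum => k; exact: differentiableZl.
Qed.

Lemma derive_row V n (f : V -> 'rV[R]_n) (x v : V) k :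
  differentiable f x -> ('D_v f x) 0 k = 'D_v (fun z => f z 0 k) x.
Proof.
by move=> df; rewrite derive_mx ?mxE//; exact: diff_derivable.
Qed.

End differentiability.

Section derive_rules.
Context (R : realType).
Implicit Types (V W X : normedModType R).

Lemma derive_comp V W X (f : V -> W) (g : W -> X) (x v : V) :
  differentiable f x -> differentiable g (f x) ->
  'D_v (g \o f) x = 'D_('D_v f x) g (f x).
Proof.
move=> df dg; rewrite [LHS]deriveE; last exact: differentiable_comp.
by rewrite (diff_comp df dg) /= (deriveE v df) (deriveE _ dg).
Qed.

Lemma derive_linear V W (f : V -> W) (x : V) (a : R) (u v : V) :
  differentiable f x -> 'D_(a *: u + v) f x = a *: 'D_u f x + 'D_v f x.
Proof. by move=> df; rewrite !(deriveE _ df) linearP. Qed.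

Lemma derive_dirD V W (f : V -> W) (x u v : V) :
  differentiable f x -> 'D_(u + v) f x = 'D_u f x + 'D_v f x.
Proof. by move=> df; rewrite !(deriveE _ df) linearD. Qed.

Lemma derive_dirB V W (f : V -> W) (x u v : V) :
  differentiable f x -> 'D_(u - v) f x = 'D_u f x - 'D_v f x.
Proof. by move=> df; rewrite !(deriveE _ df) linearB. Qed.

Lemma derive_coordE n W (f : 'rV[R]_n -> W) (x v : 'rV[R]_n) :
  differentiable f x -> 'D_v f x = \sum_i v 0 i *: 'D_(delta_mx 0 i) f x.
Proof.
move=> df; rewrite [in LHS](row_sum_delta v) (deriveE _ df) linear_sum.
by apply: eq_bigr => i _; rewrite linearZ (deriveE _ df).
Qed.

Lemma differentiable_funsum V W n (h : 'I_n -> V -> W) (x : V) :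
  (forall i, differentiable (h i) x) ->
  differentiable (fun z => \sum_(i < n) h i z) x.
Proof.
move=> dh; have -> : (fun z => \sum_(i < n) h i z) = \sum_(i < n) h i.
  by apply/funext => z; rewrite fct_sumE.
exact: differentiable_sum.
Qed.

Lemma derive_funsum V W n (h : 'I_n -> V -> W) (x v : V) :
  (forall i, differentiable (h i) x) ->
  'D_v (fun z => \sum_(i < n) h i z) x = \sum_(i < n) 'D_v (h i) x.
Proof.
move=> dh; have -> : (fun z => \sum_(i < n) h i z) = \sum_(i < n) h i.
  by apply/funext => z; rewrite fct_sumE.
by rewrite derive_sum// => i; exact: diff_derivable.
Qed.

Lemma derive_funM V (f g : V -> R) (x v : V) :
  differentiable f x -> differentiable g x ->
  'D_v (fun z => f z * g z) x = f x * 'D_v g x + 'D_v f x * g x.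
Proof.
move=> df dg.
rewrite (@deriveM _ _ f g _ _ (diff_derivable df) (diff_derivable dg)).
by congr (_ + _); exact: mulrC.
Qed.

Lemma derive_funMl V (f : V -> R) (c : R) (x v : V) :
  differentiable f x -> 'D_v (fun z => c * f z) x = c * 'D_v f x.
Proof.
move=> df; apply: (etrans (derive_funM v (differentiable_cst c x) df)).
by rewrite derive_cst mul0r addr0.
Qed.

End derive_rules.

Section smooth_functions.
Context (R : realType).
Implicit Types (V W X : normedModType R) (k : nat).

Lemma Ck_ext V W k (U : set V) (f g : V -> W) : open U ->
  (forall x, U x -> f x = g x) -> Ck k U f -> Ck k U g.
Proof.
move=> oU; elim: k f g => [|k IH] f g fg.
  move=> cf x Ux; change (g z @[z --> x] --> g x); rewrite -(fg x Ux).
  apply: cvg_trans (cf x Ux); apply: near_eq_cvg.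
  by apply: filterS (open_nbhs_nbhs (conj oU Ux)) => z /fg.
have nfg x : U x -> \forall z \near x, f z = g z.
  by move=> Ux; apply: filterS (open_nbhs_nbhs (conj oU Ux)) => z /fg.
case=> df cf; split => [x Ux|v].
  exact: near_eq_differentiable (nfg x Ux) (df x Ux).
by apply: IH (cf v) => x Ux; exact: near_eq_derive (nfg x Ux).
Qed.

Lemma Ck_sub V W k (U U' : set V) (f : V -> W) :
  U' `<=` U -> Ck k U f -> Ck k U' f.
Proof.
move=> UU; elim: k f => [|k IH] f; first by move=> H x /UU; exact: H.
by case=> df cf; split => [x /UU|v]; [exact: df|exact/IH/cf].
Qed.

Lemma CkW V W k (U : set V) (f : V -> W) : Ck k.+1 U f -> Ck k U f.
Proof.
elim: k f => [|k IH] f; case=> df cf.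
  by move=> x Ux; apply: differentiable_continuous; exact: df.
by split => // v; apply: IH; exact: cf.
Qed.

Lemma Ck_derive V W k (U : set V) (f : V -> W) v :
  Ck k.+1 U f -> Ck k U ('D_v f).
Proof. by case=> _; exact. Qed.

Lemma Ck_cst V W k (U : set V) (c : W) : Ck k U (fun=> c).
Proof.
elim: k c => [|k IH] c; first by move=> x _; exact: cst_continuous.
split => [x _|v]; first exact: differentiable_cst.
have -> : 'D_v (fun _ : V => c) = (fun=> 0).
  by apply/funext => x; exact: derive_cst.
exact: IH.
Qed.

Lemma CkD V W k (U : set V) (f g : V -> W) : open U ->
  Ck k U f -> Ck k U g -> Ck k U (fun x => f x + g x).
Proof.
move=> oU; elim: k f g => [|k IH] f g.
  by move=> cf cg x Ux; apply: cvgD; [exact: cf|exact: cg].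
move=> [df cf] [dg cg]; split => [x Ux|v].
  by apply: differentiableD; [exact: df|exact: dg].
apply: (Ck_ext oU _ (IH _ _ (cf v) (cg v))) => x Ux.
by rewrite (@deriveD _ _ _ f g)//; apply: diff_derivable; [exact: df|exact: dg].
Qed.

Lemma CkM V k (U : set V) (f g : V -> R) : open U ->
  Ck k U f -> Ck k U g -> Ck k U (fun x => f x * g x).
Proof.
move=> oU; elim: k f g => [|k IH] f g.
  by move=> cf cg x Ux; apply: cvgM; [exact: cf|exact: cg].
move=> /[dup] /CkW cf' [df cf] /[dup] /CkW cg' [dg cg]; split => [x Ux|v].
  by apply: differentiableM; [exact: df|exact: dg].
apply: (Ck_ext oU _ (CkD oU (IH _ _ cf' (cg v)) (IH _ _ (cf v) cg'))) => x Ux.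
by rewrite derive_funM//; [exact: df|exact: dg].
Qed.

Lemma CkV V k (U : set V) (f : V -> R) : open U ->
  (forall x, U x -> f x != 0) -> Ck k U f -> Ck k U (fun x => (f x)^-1).
Proof.
move=> oU f0; elim: k => [|k IH].
  by move=> cf x Ux; apply: cvgV; [exact: f0|exact: cf].
move=> /[dup] /CkW cf' [df cf]; split => [x Ux|v].
  by apply: differentiableV; [exact: df|exact: f0].
have c1 := CkM oU (Ck_cst k U (-1 : R)) (CkM oU (CkM oU (IH cf') (IH cf')) (cf v)).
apply: (Ck_ext oU _ c1) => x Ux.
rewrite (@deriveV _ _ f) ?f0//; last by apply: diff_derivable; exact: df.
by rewrite /GRing.scale/= mulN1r mulNr expr2 invfM.
Qed.

Lemma Ck_sum V W k (I : Type) (r : seq I) (P : pred I) (U : set V)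
    (h : I -> V -> W) : open U ->
  (forall i, Ck k U (h i)) -> Ck k U (fun x => \sum_(i <- r | P i) h i x).
Proof.
move=> oU ch; elim: r => [|i r IH].
  by apply: (Ck_ext oU _ (Ck_cst k U (0 : W))) => x _; rewrite big_nil.
have [Pi|Pi] := boolP (P i).
  by apply: (Ck_ext oU _ (CkD oU (ch i) IH)) => x _; rewrite big_cons Pi.
by apply: (Ck_ext oU _ IH) => x _; rewrite big_cons (negbTE Pi).
Qed.

Lemma Ck_prod V k (I : Type) (r : seq I) (P : pred I) (U : set V)
    (h : I -> V -> R) : open U ->
  (forall i, Ck k U (h i)) -> Ck k U (fun x => \prod_(i <- r | P i) h i x).
Proof.
move=> oU ch; elim: r => [|i r IH].
  by apply: (Ck_ext oU _ (Ck_cst k U (1 : R))) => x _; rewrite big_nil.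
have [Pi|Pi] := boolP (P i).
  by apply: (Ck_ext oU _ (CkM oU (ch i) IH)) => x _; rewrite big_cons Pi.
by apply: (Ck_ext oU _ IH) => x _; rewrite big_cons (negbTE Pi).
Qed.

Lemma Ck_rowP V n k (U : set V) (f : V -> 'rV[R]_n) : open U ->
  Ck k U f <-> forall i, Ck k U (fun x => f x 0 i).
Proof.
move=> oU; elim: k f => [|k IH] f.
  split=> [cf i x Ux|cf x Ux].
    apply: (@continuous_comp _ _ _ f (fun N : 'rV[R]_n => N 0 i : R) x (cf x Ux)).
    exact: coord_continuous.
  have cS : Ck 0 U (fun z => \sum_(j < n) f z 0 j *: (delta_mx 0 j : 'rV[R]_n)).
    by apply: Ck_sum => // i z Uz; apply: cvgZr_tmp; exact: cf.
  apply: (Ck_ext oU _ cS) Ux => z _.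
  by rewrite -row_sum_delta.
split=> [[df cf] i|cf].
  split=> [x Ux|v]; first by move/differentiable_rowP: (df x Ux); exact.
  apply: (Ck_ext oU _ ((IH _).1 (cf v) i)) => x Ux.
  by rewrite derive_row//; exact: df.
have df x : U x -> differentiable f x.
  by move=> Ux; apply/differentiable_rowP => i; case: (cf i) => + _; exact.
split=> // v; apply/IH => i.
case: (cf i) => _ /(_ v); apply: Ck_ext => // x Ux.
by rewrite derive_row//; exact: df.
Qed.

(** By the chain rule, the derivatives of the composite are sums of products of
    derivatives of [f] with composites of the same form, which have one order
    less to be differentiated. *)
Lemma Ck_comp V n k (U : set V) (U' : set 'rV[R]_n) (f : V -> 'rV[R]_n)
    (g : 'rV[R]_n -> R) : open U -> open U' ->
  (forall x, U x -> U' (f x)) ->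
  Ck k U f -> Ck k U' g -> Ck k U (g \o f).
Proof.
move=> oU oU' fU; elim: k g => [|k IH] g.
  by move=> cf cg x Ux; apply: continuous_comp; [exact: cf|exact/cg/fU].
move=> /[dup] /CkW cf' [df cf] [dg cg]; split => [x Ux|v].
  by apply: differentiable_comp; [exact: df|exact/dg/fU].
have c1 : Ck k U (fun x => \sum_i ('D_v f x) 0 i * ('D_(delta_mx 0 i) g \o f) x).
  apply: Ck_sum => // i; apply: CkM => //; last exact/IH/cg.
  by move/Ck_rowP: (cf v); exact.
apply: (Ck_ext oU _ c1) => x Ux.
have dfx := df x Ux; have dgx := dg _ (fU x Ux).
by rewrite (derive_comp _ dfx dgx) (derive_coordE _ dgx).
Qed.

Lemma Ck_linear V W k (U : set V) (f : {linear V -> W}) :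
  continuous f -> Ck k U f.
Proof.
move=> cf; case: k => [|k]; first by move=> x _; exact: cf.
split=> [x _|v]; first exact: linear_differentiable.
have -> : 'D_v f = fun=> f v; last exact: Ck_cst.
apply/funext => x; rewrite deriveE ?diff_lin//.
exact: linear_differentiable.
Qed.

Lemma Ck_det V k n (U : set V) (A : V -> 'M[R]_n) : open U ->
  (forall i j, Ck k U (fun x => A x i j)) -> Ck k U (fun x => \det (A x)).
Proof.
move=> oU cA; apply: Ck_sum => // s; apply: CkM => //; first exact: Ck_cst.
exact: Ck_prod.
Qed.

Lemma Ck_invmx V k n (U : set V) (A : V -> 'M[R]_n) : open U ->
  (forall x, U x -> A x \in unitmx) ->
  (forall i j, Ck k U (fun x => A x i j)) ->
  forall i j, Ck k U (fun x => invmx (A x) i j).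
Proof.
move=> oU uA cA i j.
have cdet : Ck k U (fun x => (\det (A x))^-1).
  apply: CkV => //; last exact: Ck_det.
  by move=> x /uA; rewrite unitmxE unitfE.
have cadj : Ck k U (fun x => cofactor (A x) j i).
  apply: CkM => //; first exact: Ck_cst.
  apply: Ck_det => // a b.
  by apply: (Ck_ext oU _ (cA (lift j a) (lift i b))) => x _; rewrite !mxE.
apply: (Ck_ext oU _ (CkM oU cdet cadj)) => x Ux.
by rewrite /invmx uA// !mxE.
Qed.

Lemma Ck_entry V n k (U : set V) (f : V -> 'rV[R]_n) i : open U ->
  Ck k U f -> Ck k U (fun x => f x 0 i).
Proof. by move=> oU /Ck_rowP; apply. Qed.

Lemma CkZ V W k (U : set V) (c : R) (f : V -> W) : open U ->
  Ck k U f -> Ck k U (fun x => c *: f x).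
Proof.
move=> oU; elim: k f => [|k IH] f.
  by move=> cf x Ux; apply: cvgZl_tmp; exact: cf.
move=> [df cf]; split => [x Ux|v].
  by apply: differentiableZ; exact: df.
apply: (Ck_ext oU _ (IH _ (cf v))) => x Ux.
by rewrite (@deriveZ _ _ _ f)//; apply: diff_derivable; exact: df.
Qed.

Lemma CkB V W k (U : set V) (f g : V -> W) : open U ->
  Ck k U f -> Ck k U g -> Ck k U (fun x => f x - g x).
Proof.
move=> oU cf cg; apply: (Ck_ext oU _ (CkD oU cf (CkZ (-1) oU cg))) => x _.
by rewrite scaleN1r.
Qed.

End smooth_functions.

(** * Symmetry of second derivatives *)

Section schwarz.
Context (R : realType).
Implicit Types (V W : normedModType R) (k : nat).

Lemma is_derive_line V W (f : V -> W) (u w : V) (s : R) :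
  differentiable f (s *: u + w) ->
  is_derive s 1 (fun t : R => f (t *: u + w)) ('D_u f (s *: u + w)).
Proof.
move=> df.
have da : differentiable (fun t : R => t *: u + w) s.
  exact: (@differentiableD _ _ _ (fun t : R => t *: u) (cst w)).
have Da : 'D_1 (fun t : R => t *: u + w) s = u.
  rewrite (@deriveD _ _ _ (fun t : R => t *: u) (cst w)).
  - rewrite derive_cst addr0 deriveE; last first.
      exact: (@differentiableZl _ _ _ (fun t : R => t)).
    by rewrite (@diffZl _ _ _ (fun t : R => t))// diff_val/= scale1r.
  - by apply: diff_derivable; exact: (@differentiableZl _ _ _ (fun t : R => t)).
  - exact: derivable_cst.
apply: DeriveDef.
  by apply: diff_derivable; apply: (@differentiable_comp _ _ _ _ _ f).
by have := @derive_comp _ _ _ _ _ f s 1 da df; rewrite Da.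
Qed.

Lemma mean_value_line V (f : V -> R) (u w : V) (h : R) : 0 < h ->
  (forall s, 0 <= s <= h -> differentiable f (s *: u + w)) ->
  exists2 c, 0 <= c <= h & f (h *: u + w) - f w = h * 'D_u f (c *: u + w).
Proof.
move=> h0 df.
have dl s : s \in `[0, h] -> is_derive s 1 (fun t : R => f (t *: u + w))
    ('D_u f (s *: u + w)).
  by rewrite in_itv /= => sh; apply/is_derive_line/df.
have [c ch E] := @MVT _ (fun t : R => f (t *: u + w)) _ 0 h h0
   (fun s sh => dl s (subset_itv_oo_cc sh))
   (@derivable_within_continuous _ _ _ _ (fun s sh => @ex_derive _ _ _ _ _ _ _ (dl s sh))).
exists c; first by move: (subset_itv_oo_cc ch); rewrite in_itv.
by move: E; rewrite subr0 scale0r add0r mulrC.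
Qed.

Lemma eq_of_dist_le (a b : R) : (forall e : R, 0 < e -> `|a - b| <= e) -> a = b.
Proof.
move=> H; apply/eqP; rewrite -subr_eq0 -normr_le0.
by apply/ler_addgt0Pl => e e0; rewrite addr0; exact: H.
Qed.

(** The left-hand side is symmetric in [u] and [v].  Exchanging them thus gives
    a second expression for it, with the derivatives taken in the other
    order. *)
Lemma second_difference V (f : V -> R) (U : set V) (u v x : V) (h : R) :
  0 < h -> Ck 2 U f ->
  (forall s t, 0 <= s <= h -> 0 <= t <= h -> U (s *: u + t *: v + x)) ->
  exists s t, [/\ 0 <= s <= h, 0 <= t <= h &
    f (h *: u + h *: v + x) - f (h *: u + x) - f (h *: v + x) + f x =
    h * h * 'D_v ('D_u f) (s *: u + t *: v + x)].
Proof.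
move=> h0 [df cf] inU.
have h00 : 0 <= (0 : R) <= h by rewrite lexx ltW.
have hh : 0 <= h <= h by rewrite lexx ltW.
pose g := fun z => f (z + h *: v) - f z.
have dg s : 0 <= s <= h -> differentiable g (s *: u + x) /\
    'D_u g (s *: u + x) = 'D_u f (h *: v + (s *: u + x)) - 'D_u f (s *: u + x).
  move=> sh.
  have d0 : differentiable f (s *: u + x).
    by apply: df; have := inU s 0 sh h00; rewrite scale0r addr0.
  have d1 : differentiable f (s *: u + x + h *: v).
    by apply: df; have := inU s h sh hh; rewrite addrAC.
  have dsh : differentiable (fun z : V => z + h *: v) (s *: u + x).
    exact: (@differentiableD _ _ _ id (cst (h *: v))).
  have d2 : differentiable (f \o (fun z : V => z + h *: v)) (s *: u + x).
    exact: differentiable_comp.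
  split; first exact: (@differentiableB _ _ _ (f \o (fun z : V => z + h *: v)) f).
  rewrite (@deriveB _ _ _ (f \o (fun z : V => z + h *: v)) f); [|exact: diff_derivable..].
  congr (_ - _); rewrite derive_comp// addrC; congr ('D_ _ f _).
  rewrite (@deriveD _ _ _ id (cst (h *: v))); [|exact: diff_derivable..].
  by rewrite derive_id derive_cst addr0.
have [s sh Es] := mean_value_line h0 (fun s sh => (dg s sh).1).
have [df1 _] := cf u.
have [t th Et] := @mean_value_line _ ('D_u f) v (s *: u + x) h h0 (fun t th =>
   df1 _ (eq_rect _ U (inU s t sh th) _
     (etrans (congr1 (+%R^~ x) (addrC _ _)) (esym (addrA _ _ _))))).
exists s, t; split; [exact: sh|exact: th|].
move: Es; rewrite (dg s sh).2 Et /g => Es.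
have E1 : s *: u + t *: v + x = t *: v + (s *: u + x).
  by rewrite addrA [t *: v + _]addrC.
rewrite E1 -mulrA -Es.
rewrite [h *: u + x + h *: v]addrAC [x + _]addrC.
by rewrite opprD opprK !addrA.
Qed.

(** Dividing by [h * h] and letting [h] tend to 0 identifies the two limits. *)
Lemma eq_second_differences V (f A B : V -> R) (U : set V) (u v x : V) :
  open U -> U x -> {for x, continuous A} -> {for x, continuous B} ->
  (forall h : R, 0 < h ->
    (forall s t, 0 <= s <= h -> 0 <= t <= h -> U (s *: u + t *: v + x)) ->
    exists s t, [/\ 0 <= s <= h, 0 <= t <= h &
      f (h *: u + h *: v + x) - f (h *: u + x) - f (h *: v + x) + f x =
      h * h * A (s *: u + t *: v + x)]) ->
  (forall h : R, 0 < h ->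
    (forall s t, 0 <= s <= h -> 0 <= t <= h -> U (s *: v + t *: u + x)) ->
    exists s t, [/\ 0 <= s <= h, 0 <= t <= h &
      f (h *: v + h *: u + x) - f (h *: v + x) - f (h *: u + x) + f x =
      h * h * B (s *: v + t *: u + x)]) ->
  B x = A x.
Proof.
move=> oU Ux cA cB sdA sdB; apply: eq_of_dist_le => e e0.
have e20 : 0 < e / 2 by rewrite divr_gt0.
move/cvgrPdist_lt: cA => /(_ _ e20) nA.
move/cvgrPdist_lt: cB => /(_ _ e20) nB.
have nU := open_nbhs_nbhs (conj oU Ux).
have [d /= d0 dP] := (nbhs_ballP x _).1 (filterI nU (filterI nA nB)).
(* Small enough for the whole parallelogram to lie in the ball of radius [d]. *)
pose h := d / (1 + `|u| + `|v|).
have n0 : 0 < 1 + `|u| + `|v| by rewrite -addrA ltr_pwDl// addr_ge0.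
have h0 : 0 < h by rewrite divr_gt0.
have inB s t : 0 <= s <= h -> 0 <= t <= h -> ball x d (s *: u + t *: v + x).
  move=> /andP[s0 sh] /andP[t0 th].
  rewrite -ball_normE /ball_/= opprD addrCA addrN addr0 normrN.
  apply: (le_lt_trans (ler_normD _ _)).
  rewrite !normrZ (ger0_norm s0) (ger0_norm t0).
  apply: (@le_lt_trans _ _ (h * `|u| + h * `|v|)).
    by rewrite lerD// ler_wpM2r.
  by rewrite -mulrDr /h mulrAC ltr_pdivrMr// ltr_pM2l// -addrA ltrDr.
have inB' s t : 0 <= s <= h -> 0 <= t <= h -> ball x d (s *: v + t *: u + x).
  by move=> sh' th'; rewrite [s *: v + _]addrC; exact: inB.
have [s [t [sh th E1]]] := sdA h h0 (fun s t sh th => (dP _ (inB s t sh th)).1).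
have [s' [t' [sh' th' E2]]] :=
  sdB h h0 (fun s t sh th => (dP _ (inB' s t sh th)).1).
have E : A (s *: u + t *: v + x) = B (s' *: v + t' *: u + x).
  have hh : h * h != 0 by rewrite mulf_neq0// gt_eqF.
  apply: (mulfI hh); rewrite -E1 -E2 [h *: v + h *: u]addrC.
  by rewrite -[X in _ = X + _]addrA [X in _ = _ + X + _]addrC addrA.
have [_ [A1 _]] := dP _ (inB s t sh th).
have [_ [_ B1]] := dP _ (inB' s' t' sh' th').
rewrite -(subrKA (B (s' *: v + t' *: u + x))).
apply: (le_trans (ler_normD _ _)); rewrite [e]splitr lerD//; first exact: ltW.
by rewrite distrC -E ltW.
Qed.

Lemma schwarz_real V (f : V -> R) (U : set V) (u v x : V) : open U ->
  Ck 2 U f -> U x -> 'D_u ('D_v f) x = 'D_v ('D_u f) x.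
Proof.
move=> oU cf Ux; have [_ c2] := cf.
apply: (eq_second_differences oU Ux (proj2 (c2 u) v x Ux)
  (proj2 (c2 v) u x Ux)) => h h0.
- exact: (@second_difference _ f U u v x h h0 cf).
- exact: (@second_difference _ f U v u x h h0 cf).
Qed.

Lemma schwarz V n (f : V -> 'rV[R]_n) (U : set V) (u v x : V) : open U ->
  Ck 2 U f -> U x -> 'D_u ('D_v f) x = 'D_v ('D_u f) x.
Proof.
move=> oU cf Ux; have [df c1] := cf.
have d1 a z : U z -> differentiable ('D_a f) z by have [] := c1 a => + _; exact.
apply/rowP => i.
have E a b : ('D_a ('D_b f) x) 0 i = 'D_a ('D_b (fun z => f z 0 i)) x.
  rewrite derive_row; last exact: d1.
  apply: near_eq_derive; apply: filterS (open_nbhs_nbhs (conj oU Ux)) => z Uz.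
  by rewrite derive_row//; exact: df.
have H := schwarz_real u v oU ((Ck_rowP 2 f oU).1 cf i) Ux.
apply: (etrans (E u v)).
apply: (etrans _ (esym (E v u))).
exact: H.
Qed.

End schwarz.

(** * Bilinear forms and Koszul's formula *)

Section inner_algebra.
Context (R : realType) (n : nat).
Implicit Types (G : 'M[R]_n) (u v w : 'rV[R]_n).

Lemma innerE G u v : inner G u v = \sum_i \sum_j u 0 i * G i j * v 0 j.
Proof.
rewrite /inner mxE exchange_big /=; apply: eq_bigr => j _.
by rewrite mxE big_distrl /=; apply: eq_bigr => i _; rewrite !mxE.
Qed.

Lemma innerDl G u v w : inner G (u + v) w = inner G u w + inner G v w.
Proof. by rewrite /inner !mulmxDl mxE. Qed.

Lemma innerDr G u v w : inner G w (u + v) = inner G w u + inner G w v.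
Proof. by rewrite /inner linearD mulmxDr mxE. Qed.

Lemma innerZl G (a : R) u w : inner G (a *: u) w = a * inner G u w.
Proof. by rewrite /inner -!scalemxAl mxE. Qed.

Lemma innerZr G (a : R) u w : inner G w (a *: u) = a * inner G w u.
Proof. by rewrite /inner linearZ -!scalemxAr mxE. Qed.

Lemma innerC G u v : G^T = G -> inner G u v = inner G v u.
Proof.
move=> GT; rewrite /inner.
transitivity ((u *m G *m v^T)^T 0 0); first by rewrite [RHS]mxE.
by rewrite !trmx_mul trmxK GT mulmxA.
Qed.

Lemma inner_mul (J : 'M[R]_n) G u v :
  inner (J *m G *m J^T) u v = inner G (u *m J) (v *m J).
Proof. by rewrite /inner trmx_mul !mulmxA. Qed.

Lemma inner_nondeg G u v : G \in unitmx ->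
  (forall w, inner G u w = inner G v w) -> u = v.
Proof.
move=> uG H; have E : u *m G = v *m G.
  apply/rowP => i; have := H (delta_mx 0 i).
  by rewrite /inner !trmx_delta -!colE !mxE.
by rewrite -[u](mulmxK uG) E mulmxK.
Qed.

(** A vector of the kernel has norm zero. *)
Lemma posdef_unitmx G : (forall v, v != 0 -> 0 < inner G v v) -> G \in unitmx.
Proof.
move=> pG; rewrite -row_free_unit; apply/row_freeP.
apply/row_freeP; apply/inj_row_free => v vG; apply/eqP; apply: contraT => /pG.
by rewrite /inner vG mul0mx mxE ltxx.
Qed.

End inner_algebra.

Section product_rules.
Context (R : realType).
Implicit Types (V W : normedModType R) (k : nat).

Lemma derive_funM3 V (f g h : V -> R) (x v : V) :
  differentiable f x -> differentiable g x -> differentiable h x ->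
  'D_v (fun z => f z * g z * h z) x =
  'D_v f x * g x * h x + f x * 'D_v g x * h x + f x * g x * 'D_v h x.
Proof.
move=> df dg dh.
have dfg : differentiable (fun z => f z * g z) x by exact: differentiableM.
apply: (etrans (derive_funM v dfg dh)).
by rewrite (derive_funM v df dg) mulrDl addrC [X in X + _ = _]addrC.
Qed.

Lemma differentiable_inner V n (T : V -> 'M[R]_n) (a b : V -> 'rV[R]_n) (x : V) :
  (forall i j, differentiable (fun z => T z i j) x) ->
  differentiable a x -> differentiable b x ->
  differentiable (fun z => inner (T z) (a z) (b z)) x.
Proof.
move=> dT /differentiable_rowP da /differentiable_rowP db.
rewrite (_ : (fun z => _) =
    (fun z => \sum_i \sum_j a z 0 i * T z i j * b z 0 j)); last first.
  by apply/funext => z; exact: innerE.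
apply: differentiable_funsum => i; apply: differentiable_funsum => j.
apply: differentiableM; last exact: db.
by apply: differentiableM; [exact: da|exact: dT].
Qed.

Lemma derive_inner0 V n (T : V -> 'M[R]_n) (a b : V -> 'rV[R]_n) (x u : V) :
  (forall i j, differentiable (fun z => T z i j) x) ->
  differentiable a x -> differentiable b x ->
  'D_u (fun z => inner (T z) (a z) (b z)) x =
  \sum_i \sum_j a x 0 i * 'D_u (fun z => T z i j) x * b x 0 j
  + inner (T x) ('D_u a x) (b x) + inner (T x) (a x) ('D_u b x).
Proof.
move=> dT da db.
have da' := (differentiable_rowP _ _).1 da.
have db' := (differentiable_rowP _ _).1 db.
rewrite (_ : (fun z => _) =
    (fun z => \sum_i \sum_j a z 0 i * T z i j * b z 0 j)); last first.
  by apply/funext => z; exact: innerE.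
have dij i j : differentiable (fun z => a z 0 i * T z i j * b z 0 j) x.
  apply: differentiableM; last exact: db'.
  by apply: differentiableM; [exact: da'|exact: dT].
rewrite derive_funsum; last by move=> i; exact: differentiable_funsum.
rewrite !innerE -!big_split /=; apply: eq_bigr => i _.
rewrite derive_funsum// -!big_split /=; apply: eq_bigr => j _.
apply: (etrans (derive_funM3 u (da' i) (dT i j) (db' j))).
rewrite -(derive_row u i da) -(derive_row u j db).
by rewrite [X in X + _ = _]addrC.
Qed.

(** The form is moved by [f] and the vectors by [a] and [b]: each of the three
    is varied while the other two are frozen at [x]. *)
Lemma derive_inner V k n (T : 'rV[R]_k -> 'M[R]_n) (f : V -> 'rV[R]_k)
    (a b : V -> 'rV[R]_n) (x u : V) :
  differentiable f x ->
  (forall i j, differentiable (fun z => T z i j) (f x)) ->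
  differentiable a x -> differentiable b x ->
  'D_u (fun z => inner (T (f z)) (a z) (b z)) x =
  'D_('D_u f x) (fun y => inner (T y) (a x) (b x)) (f x)
  + inner (T (f x)) ('D_u a x) (b x) + inner (T (f x)) (a x) ('D_u b x).
Proof.
move=> df dT da db.
have dTf i j : differentiable (fun z => T (f z) i j) x.
  exact: (@differentiable_comp _ _ _ _ f (fun z => T z i j)).
apply: (etrans (derive_inner0 u dTf da db)); congr (_ + _ + _).
apply: esym; apply: (etrans (@derive_inner0 _ _ T (cst (a x)) (cst (b x)) (f x) _ dT
  (differentiable_cst _ _) (differentiable_cst _ _))).
rewrite !derive_cst /inner mul0mx mul0mx trmx0 mulmx0 !mxE !addr0.
apply: eq_bigr => i _; apply: eq_bigr => j _; congr (_ * _ * _).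
by rewrite -(@derive_comp _ _ _ _ f (fun z => T z i j)).
Qed.

(** In coordinates ['D_(a z) g] is a sum of products, so that the base point and
    the direction contribute one term each. *)
Lemma derive_moving_real V k (g : 'rV[R]_k -> R) (f a : V -> 'rV[R]_k) (x u : V) :
  differentiable f x -> differentiable a x ->
  (\forall z \near x, differentiable g (f z)) ->
  (\forall y \near f x, differentiable g y) ->
  (forall w, differentiable ('D_w g) (f x)) ->
  'D_u (fun z => 'D_(a z) g (f z)) x =
  'D_('D_u f x) ('D_(a x) g) (f x) + 'D_('D_u a x) g (f x).
Proof.
move=> df da ndg ndg' ddg.
have da' := (differentiable_rowP _ _).1 da.
pose e i : 'rV[R]_k := delta_mx 0 i.
have E1 : 'D_u (fun z => 'D_(a z) g (f z)) x =
          'D_u (fun z => \sum_i a z 0 i * ('D_(e i) g \o f) z) x.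
  apply: near_eq_derive; apply: filterS ndg => z dz.
  exact: (derive_coordE (a z) dz).
have E2 : 'D_('D_u f x) ('D_(a x) g) (f x) =
          'D_('D_u f x) (fun y => \sum_i a x 0 i * ('D_(e i) g) y) (f x).
  apply: near_eq_derive; apply: filterS ndg' => y dy.
  exact: (derive_coordE (a x) dy).
have dcomp i : differentiable ('D_(e i) g \o f) x.
  exact: differentiable_comp.
have dM i : differentiable (fun z => a z 0 i * ('D_(e i) g \o f) z) x.
  exact: (differentiableM (da' i) (dcomp i)).
have dM' i : differentiable (fun y => a x 0 i * ('D_(e i) g) y) (f x).
  by apply: differentiableM; [exact: differentiable_cst|exact: ddg].
apply: (etrans E1); apply: (etrans (derive_funsum u dM)).
apply: (etrans _ (esym (congr1 (+%R^~ _) (etrans E2 (derive_funsum _ dM'))))).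
rewrite (derive_coordE _ (nbhs_singleton ndg')) -big_split /=.
apply: eq_bigr => i _.
apply: (etrans (derive_funM u (da' i) (dcomp i))); congr (_ + _).
  apply: esym.
  have H := derive_funMl (a x 0 i) ('D_u f x) (ddg (e i)).
  apply: (etrans H).
  apply: (congr1 ( *%R (a x 0 i))).
  by apply: esym; exact: derive_comp.
by rewrite -(derive_row u i da).
Qed.

Lemma derive_moving V k l (g : 'rV[R]_k -> 'rV[R]_l) (f a : V -> 'rV[R]_k)
    (x u : V) :
  differentiable f x -> differentiable a x ->
  (\forall z \near x, differentiable g (f z)) ->
  (\forall y \near f x, differentiable g y) ->
  (forall w, differentiable ('D_w g) (f x)) ->
  differentiable (fun z => 'D_(a z) g (f z)) x /\
  'D_u (fun z => 'D_(a z) g (f z)) x =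
  'D_('D_u f x) ('D_(a x) g) (f x) + 'D_('D_u a x) g (f x).
Proof.
move=> df da ndg ndg' ddg.
have dD : differentiable (fun z => 'D_(a z) g (f z)) x.
  have da' := (differentiable_rowP _ _).1 da.
  apply: (@near_eq_differentiable _ _ _ (fun z => \sum_i a z 0 i *: 'D_(delta_mx 0 i) g (f z))).
    by apply: filterS ndg => z dz; exact: (esym (derive_coordE (a z) dz)).
  apply: differentiable_funsum => i; apply/differentiable_rowP => j.
  rewrite (_ : (fun z => _) = (fun z => a z 0 i * ('D_(delta_mx 0 i) g (f z)) 0 j)); last first.
    by apply/funext => z; rewrite mxE.
  apply: differentiableM; first exact: da'.
  have := (differentiable_rowP _ _).1 (differentiable_comp df (ddg (delta_mx 0 i))) j.
  exact.
split=> //; apply/rowP => j; rewrite mxE.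
pose gj y := g y 0 j.
have ngj : \forall y \near f x, differentiable gj y.
  by apply: filterS ndg' => y /differentiable_rowP; exact.
have ngj' : \forall z \near x, differentiable gj (f z).
  by apply: filterS ndg => y /differentiable_rowP; exact.
have eqj w : \forall y \near f x, ('D_w g y) 0 j = 'D_w gj y.
  by apply: filterS ndg' => y dy; exact: derive_row.
have ddgj w : differentiable ('D_w gj) (f x).
  apply: near_eq_differentiable (eqj w) _.
  by have /differentiable_rowP := ddg w; exact.
apply: (etrans (derive_row u j dD)).
have -> : 'D_u (fun z => ('D_(a z) g (f z)) 0 j) x = 'D_u (fun z => 'D_(a z) gj (f z)) x.
  by apply: near_eq_derive; apply: filterS ndg => z dz; exact: derive_row.
apply: (etrans (derive_moving_real u df da ngj' ngj ddgj)); congr (_ + _).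
  apply: esym; apply: (etrans (derive_row _ j (ddg _))).
  exact: near_eq_derive (eqj _).
by apply: esym; apply: derive_row; exact: (nbhs_singleton ndg').
Qed.

Lemma derive_moving_id k l (g : 'rV[R]_k -> 'rV[R]_l) (a : 'rV[R]_k -> 'rV[R]_k)
    (x u : 'rV[R]_k) :
  differentiable a x -> (\forall y \near x, differentiable g y) ->
  (forall w, differentiable ('D_w g) x) ->
  'D_u (fun z => 'D_(a z) g z) x = 'D_u ('D_(a x) g) x + 'D_('D_u a x) g x.
Proof.
move=> da ndg ddg.
have [_ E] := @derive_moving _ _ _ g id a x u (ex_diff : differentiable id x)
  da ndg ndg ddg.
exact: (etrans E (congr1 (fun t => 'D_t ('D_(a x) g) x + 'D_('D_u a x) g x)
  (derive_id x u))).
Qed.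

End product_rules.

Section christoffel_theory.
Context (R : realType) (n : nat).
Implicit Types (G : 'rV[R]_n -> 'M[R]_n) (u v w y : 'rV[R]_n) (U : set 'rV[R]_n).

(** Koszul's formula for the inner product of [nabla_u v] with [w], for constant
    fields, whose Lie brackets vanish. *)
Definition koszul G y u v w : R :=
  2^-1 * ('D_u (fun z => inner (G z) v w) y + 'D_v (fun z => inner (G z) u w) y
          - 'D_w (fun z => inner (G z) u v) y).

Lemma derive_inner_cst G y u v w :
  (forall i j, differentiable (fun z => G z i j) y) ->
  'D_u (fun z => inner (G z) v w) y =
  \sum_a \sum_i \sum_j u 0 a * v 0 i * w 0 j * partial a (fun z => G z i j) y.
Proof.
move=> dG; apply: (etrans (@derive_inner0 _ _ _ G (cst v) (cst w) y u dG
  (differentiable_cst _ _) (differentiable_cst _ _))).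
rewrite !derive_cst /inner mul0mx mul0mx trmx0 mulmx0 !mxE !addr0.
rewrite exchange_big /=; apply: esym; rewrite exchange_big /=.
rewrite [RHS]exchange_big; apply: eq_bigr => i _.
rewrite exchange_big /=; apply: eq_bigr => j _.
rewrite (derive_coordE u (dG i j)) mulr_sumr mulr_suml.
apply: eq_bigr => a _; rewrite /partial /GRing.scale/=.
by rewrite [LHS]mulrAC [u 0 a * _]mulrC !mulrA mulrAC.
Qed.

(** The inverse of the metric in the Christoffel symbols cancels against the
    metric.  The connection is thereby characterised without inverse matrices,
    in a form that behaves well under a change of coordinates. *)
Lemma christoffel_koszul G y u v w :
  (forall i j, differentiable (fun z => G z i j) y) ->
  (G y)^T = G y -> G y \in unitmx ->
  inner (G y) (christoffel_map G y u v) w = koszul G y u v w.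
Proof.
move=> dG GT uG.
pose X a b d := partial a (fun z => G z b d) y + partial b (fun z => G z a d) y
                - partial d (fun z => G z a b) y.
pose k : 'rV[R]_n := \row_d \sum_a \sum_b 2^-1 * X a b d * u 0 a * v 0 b.
have -> : christoffel_map G y u v = k *m invmx (G y).
  apply/rowP => c; rewrite !mxE.
  transitivity (\sum_d \sum_a \sum_b
      2^-1 * (invmx (G y) c d * X a b d) * u 0 a * v 0 b).
    rewrite [RHS]exchange_big /=; apply: eq_bigr => a _.
    rewrite [RHS]exchange_big /=; apply: eq_bigr => b _.
    by rewrite /christoffel mulr_sumr !mulr_suml.
  apply: eq_bigr => d _; rewrite mxE mulr_suml; apply: eq_bigr => a _.
  rewrite mulr_suml; apply: eq_bigr => b _.
  have -> : invmx (G y) c d = invmx (G y) d c.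
    have <- : (invmx (G y))^T = invmx (G y) by rewrite trmx_inv GT.
    by rewrite [LHS]mxE trmx_inv GT.
  ring.
rewrite /inner mulmxKV// /koszul mxE.
rewrite !(derive_inner_cst _ _ _ dG).
set T1 := (X in X + _ - _); set T2 := (X in _ + X - _); set T3 := (X in _ - X).
have E2 : T2 = \sum_a \sum_b \sum_d
    v 0 b * u 0 a * w 0 d * partial b (fun z => G z a d) y.
  by rewrite /T2 exchange_big.
have E3 : T3 = \sum_a \sum_b \sum_d
    w 0 d * u 0 a * v 0 b * partial d (fun z => G z a b) y.
  rewrite /T3 exchange_big; apply: eq_bigr => a _ /=.
  by rewrite exchange_big.
rewrite E2 E3 /T1 -big_split /= -sumrB mulr_sumr.
transitivity (\sum_d \sum_a \sum_b
    2^-1 * X a b d * u 0 a * v 0 b * w 0 d).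
  apply: eq_bigr => d _; rewrite !mxE mulr_suml; apply: eq_bigr => a _.
  by rewrite mulr_suml.
rewrite exchange_big /=; apply: eq_bigr => a _.
rewrite exchange_big /= -big_split /= -sumrB mulr_sumr; apply: eq_bigr => b _.
rewrite -big_split /= -sumrB mulr_sumr; apply: eq_bigr => d _.
by rewrite /X; ring.
Qed.

End christoffel_theory.

(** * Christoffel symbols of a metric on an open set of R^n *)

Definition coord_metric (R : realType) n (U : set 'rV[R]_n)
    (G : 'rV[R]_n -> 'M[R]_n) : Prop :=
  [/\ open U, forall a b, smooth_on U (fun y => G y a b),
      forall y, U y -> (G y)^T = G y &
      forall y, U y -> forall v, v != 0 -> 0 < inner (G y) v v].

Section smooth_on_theory.
Context (R : realType).
Implicit Types (V W : normedModType R).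

Lemma smooth_differentiable V W (U : set V) (f : V -> W) (x : V) :
  smooth_on U f -> U x -> differentiable f x.
Proof. by move=> /(_ 1%N) [df _]; exact: df. Qed.

Lemma smooth_derive V W (U : set V) (f : V -> W) (v : V) :
  smooth_on U f -> smooth_on U ('D_v f).
Proof. by move=> sf k; exact: (Ck_derive v (sf k.+1)). Qed.

Lemma smooth_differentiable_near V W (U : set V) (f : V -> W) (x : V) :
  open U -> smooth_on U f -> U x -> \forall z \near x, differentiable f z.
Proof.
move=> oU sf Ux; apply: filterS (open_nbhs_nbhs (conj oU Ux)) => z Uz.
exact: (smooth_differentiable sf Uz).
Qed.

End smooth_on_theory.

Section christoffel_smooth.
Context (R : realType) (n : nat).
Variables (U : set 'rV[R]_n) (G : 'rV[R]_n -> 'M[R]_n).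
Hypothesis mG : coord_metric U G.

Let oU : open U. Proof. by case: mG. Qed.
Let sG a b : smooth_on U (fun y => G y a b). Proof. by case: mG. Qed.

Lemma coord_metric_unitmx y : U y -> G y \in unitmx.
Proof. by case: mG => _ _ _ pG /pG; exact: posdef_unitmx. Qed.

Lemma smooth_christoffel a b c : smooth_on U (fun y => christoffel G y a b c).
Proof.
move=> k; have dG i j d : Ck k U (partial d (fun z => G z i j)).
  exact: (Ck_derive _ (sG i j k.+1)).
apply: CkM => //; first exact: Ck_cst.
apply: Ck_sum => // d; apply: CkM => //.
  by apply: Ck_invmx => // [y Uy|i j]; [exact: coord_metric_unitmx|exact: sG].
by apply: CkB => //; apply: CkD.
Qed.

(** A component of [christoffel_map], as a bilinear form to which the rules for
    [inner] apply. *)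
Definition christoffel_form (c : 'I_n) (y : 'rV[R]_n) : 'M[R]_n :=
  \matrix_(a, b) christoffel G y a b c.

Lemma christoffel_mapE y u v c :
  (christoffel_map G y u v) 0 c = inner (christoffel_form c y) u v.
Proof.
rewrite mxE innerE; apply: eq_bigr => a _; apply: eq_bigr => b _.
by rewrite mxE [X in X * _]mulrC.
Qed.

Lemma differentiable_christoffel_form c y : U y ->
  forall i j, differentiable (fun z => christoffel_form c z i j) y.
Proof.
move=> Uy i j; rewrite (_ : (fun z => _) = (fun z => christoffel G z i j c)).
  exact: (smooth_differentiable (smooth_christoffel i j c) Uy).
by apply/funext => z; rewrite mxE.
Qed.

Lemma derive_christoffel_map (V : normedModType R) (f a b : V -> 'rV[R]_n) x u :
  U (f x) -> differentiable f x -> differentiable a x -> differentiable b x ->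
  differentiable (fun z => christoffel_map G (f z) (a z) (b z)) x /\
  'D_u (fun z => christoffel_map G (f z) (a z) (b z)) x =
  'D_('D_u f x) (fun y => christoffel_map G y (a x) (b x)) (f x)
  + christoffel_map G (f x) ('D_u a x) (b x)
  + christoffel_map G (f x) (a x) ('D_u b x).
Proof.
move=> Ufx df da db.
have dc c := differentiable_christoffel_form c Ufx.
have E W (f' a' b' : W -> 'rV[R]_n) c :
    (fun z => (christoffel_map G (f' z) (a' z) (b' z)) 0 c) =
    (fun z => inner (christoffel_form c (f' z)) (a' z) (b' z)).
  by apply/funext => z; exact: christoffel_mapE.
have dfc c i j : differentiable (fun z => christoffel_form c (f z) i j) x.
  exact: (@differentiable_comp _ _ _ _ f (fun z => christoffel_form c z i j)).
have D : differentiable (fun z => christoffel_map G (f z) (a z) (b z)) x.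
  apply/differentiable_rowP => c; rewrite E.
  exact: differentiable_inner.
have D' : differentiable (fun y => christoffel_map G y (a x) (b x)) (f x).
  apply/differentiable_rowP => c.
  rewrite (E _ id (fun=> a x) (fun=> b x)).
  by apply: differentiable_inner; [exact: dc|exact: differentiable_cst..].
split=> //; apply/rowP => c.
apply: (etrans (derive_row u c D)); rewrite E [RHS]mxE [in RHS]mxE.
rewrite !christoffel_mapE.
apply: (etrans (derive_inner u df (dc c) da db)); congr (_ + _ + _).
apply: esym; apply: (etrans (derive_row _ c D')).
by rewrite (E _ id (fun=> a x) (fun=> b x)).
Qed.

Lemma differentiable_christoffel_map b c y : U y ->
  differentiable (fun z => christoffel_map G z b c) y.
Proof.
move=> Uy; have [D _] := @derive_christoffel_map _ id (cst b) (cst c)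
  y 0 Uy (ex_diff : differentiable id y)
  (differentiable_cst _ _) (differentiable_cst _ _).
exact: D.
Qed.

Lemma christoffel_mapDl y u u' v : christoffel_map G y (u + u') v =
  christoffel_map G y u v + christoffel_map G y u' v.
Proof. by apply/rowP => c; rewrite [RHS]mxE !christoffel_mapE innerDl. Qed.

Lemma christoffel_mapDr y u v v' : christoffel_map G y u (v + v') =
  christoffel_map G y u v + christoffel_map G y u v'.
Proof. by apply/rowP => c; rewrite [RHS]mxE !christoffel_mapE innerDr. Qed.

Lemma christoffel_mapZl y (s : R) u v :
  christoffel_map G y (s *: u) v = s *: christoffel_map G y u v.
Proof. by apply/rowP => c; rewrite [RHS]mxE !christoffel_mapE innerZl. Qed.

Lemma christoffel_mapZr y (s : R) u v :
  christoffel_map G y u (s *: v) = s *: christoffel_map G y u v.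
Proof. by apply/rowP => c; rewrite [RHS]mxE !christoffel_mapE innerZr. Qed.

Lemma christoffel_map0l y v : christoffel_map G y 0 v = 0.
Proof. by rewrite -(scale0r 0) christoffel_mapZl !scale0r. Qed.

Lemma christoffel_map0r y v : christoffel_map G y v 0 = 0.
Proof. by rewrite -(scale0r 0) christoffel_mapZr !scale0r. Qed.

(** Constant fields commute, so the bracket term of the curvature is zero. *)
Lemma curvature_atE y u v w : curvature_at G y u v w =
  'D_u (fun z => christoffel_map G z v w) y
  + christoffel_map G y u (christoffel_map G y v w)
  - ('D_v (fun z => christoffel_map G z u w) y
     + christoffel_map G y v (christoffel_map G y u w)).
Proof.
have E a b : levi_civita G (fun=> a) (fun=> b) = fun z => christoffel_map G z a b.
  by apply/funext => z; rewrite /levi_civita (derive_cst b z a) add0r.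
rewrite /curvature_at /curvature !E.
have -> : lie_bracket (fun=> u) (fun=> v) = fun _ : 'rV[R]_n => 0.
  apply/funext => z; rewrite /lie_bracket.
  by rewrite (derive_cst v z u) (derive_cst u z v) subrr.
by rewrite E christoffel_map0l subr0.
Qed.

End christoffel_smooth.

(** * Change of coordinates *)

Lemma koszul_algebra (R : realType) (a b c p q q' r : R) : q = q' ->
  2^-1 * ((a + p + q) + (b + p + r) - (c + q' + r)) = p + 2^-1 * (a + b - c).
Proof. by move=> ->; field. Qed.

Lemma curvature_algebra (R : realType) n (P Q T K S1 S2 L1 L2 : 'rV[R]_n) :
  Q + P = T + (K + L1 + L2) ->
  P + (Q + (S1 + S2)) = K + S2 + (T + L1 + (S1 + L2)).
Proof.
by move=> /rowP E; apply/rowP => i; move: (E i); rewrite !mxE; lra.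
Qed.

Lemma antisym_algebra (V : zmodType) (A A' T T' L L' M1 M2 : V) :
  T = T' -> L = L' ->
  A + (T + L + (M1 + M2)) - (A' + (T' + L' + (M2 + M1))) = A - A'.
Proof.
by move=> -> ->; rewrite [M2 + M1]addrC opprD addrACA subrr addr0.
Qed.

Section change_of_coordinates.
Context (R : realType) (n : nat).
Variables (U U' : set 'rV[R]_n) (G G' : 'rV[R]_n -> 'M[R]_n).
Variable psi : 'rV[R]_n -> 'rV[R]_n.
Hypotheses (mG : coord_metric U G) (mG' : coord_metric U' G').
Hypotheses (spsi : smooth_on U psi) (psiU : forall y, U y -> U' (psi y)).
Hypothesis iso : forall y u v, U y ->
  inner (G y) u v = inner (G' (psi y)) ('D_u psi y) ('D_v psi y).

Let oU : open U. Proof. by case: mG. Qed.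
Let dG y i j : U y -> differentiable (fun z => G z i j) y.
Proof. by move=> Uy; case: mG => _ sG _ _; exact: (smooth_differentiable (sG i j) Uy). Qed.
Let dG' y i j : U' y -> differentiable (fun z => G' z i j) y.
Proof. by move=> Uy; case: mG' => _ sG _ _; exact: (smooth_differentiable (sG i j) Uy). Qed.
Let dpsi y : U y -> differentiable psi y.
Proof. exact: smooth_differentiable. Qed.
Let dpsi1 v y : U y -> differentiable ('D_v psi) y.
Proof. exact: (smooth_differentiable (smooth_derive v spsi)). Qed.
Let nearU (P : 'rV[R]_n -> Prop) y : (forall z, U z -> P z) -> U y ->
  \forall z \near y, P z.
Proof.
move=> UP Uy; apply: filterS (open_nbhs_nbhs (conj oU Uy)) => z; exact: UP.
Qed.

(** The differential of an isometry is injective because the metric is definite,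
    hence onto because the dimensions agree. *)
Lemma isometry_onto y w' : U y -> exists w, 'D_w psi y = w'.
Proof.
move=> Uy; have uJ : jacobian psi y \in unitmx.
  rewrite -row_free_unit; apply/inj_row_free => v vJ; apply/eqP.
  apply: contraT => v0; have : 0 < inner (G y) v v.
    by case: mG => _ _ _ pG; exact: pG.
  rewrite (iso _ _ Uy) (deriveEjacobian v (dpsi Uy)) vJ.
  by rewrite /inner mul0mx mul0mx mxE ltxx.
exists (w' *m invmx (jacobian psi y)).
by rewrite (deriveEjacobian _ (dpsi Uy)) mulmxKV.
Qed.

Lemma derive_metric_change y u v w : U y ->
  'D_u (fun z => inner (G z) v w) y =
  'D_('D_u psi y) (fun x => inner (G' x) ('D_v psi y) ('D_w psi y)) (psi y)
  + inner (G' (psi y)) ('D_u ('D_v psi) y) ('D_w psi y)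
  + inner (G' (psi y)) ('D_v psi y) ('D_u ('D_w psi) y).
Proof.
move=> Uy.
have H : \forall z \near y,
    inner (G z) v w = inner (G' (psi z)) ('D_v psi z) ('D_w psi z).
  by apply: (nearU _ Uy) => z Uz; exact: iso.
apply: (etrans (near_eq_derive u H)).
have := @derive_inner _ _ _ _ G' psi ('D_v psi) ('D_w psi) y u (dpsi Uy)
  (fun i j => dG' i j (psiU Uy)) (dpsi1 v Uy) (dpsi1 w Uy).
exact.
Qed.

(** Both connections are characterised by Koszul's formula.  Six terms with
    second derivatives of [psi] come up when the formula for [G] is expressed by
    [G'].  These derivatives are symmetric, so four of the terms cancel and the
    other two add up to the one displayed. *)
Lemma christoffel_change y u v : U y ->
  'D_(christoffel_map G y u v) psi y =
  'D_u ('D_v psi) y + christoffel_map G' (psi y) ('D_u psi y) ('D_v psi y).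
Proof.
move=> Uy; have U'y := psiU Uy.
case: (mG) => _ _ tG _; case: (mG') => _ _ tG' _.
have uG' := coord_metric_unitmx mG' U'y.
have uG := coord_metric_unitmx mG Uy.
apply: (inner_nondeg uG') => w'; have [w <-] := isometry_onto w' Uy.
rewrite -(iso _ _ Uy) innerDl.
rewrite (christoffel_koszul _ _ _ (fun i j => dG i j Uy) (tG _ Uy) uG).
rewrite (christoffel_koszul _ _ _ (fun i j => dG' i j U'y) (tG' _ U'y) uG').
rewrite /koszul.
have [B BE] : exists B, forall a b, 'D_a ('D_b psi) y = B a b.
  by exists (fun a b => 'D_a ('D_b psi) y).
have BC a b : B a b = B b a by rewrite -!BE; exact: (schwarz a b oU (spsi 2) Uy).
have D a b c := derive_metric_change a b c Uy.
have {}D a b c : 'D_a (fun z => inner (G z) b c) y =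
    'D_('D_a psi y) (fun x => inner (G' x) ('D_b psi y) ('D_c psi y)) (psi y)
    + inner (G' (psi y)) (B a b) ('D_c psi y)
    + inner (G' (psi y)) ('D_b psi y) (B a c).
  by rewrite -(BE a b) -(BE a c); exact: D.
rewrite (BE u v) (D u v w) (D v u w) (D w u v).
rewrite (BC v u) (BC w u) (BC w v).
apply: koszul_algebra.
exact: (innerC _ _ (tG' _ U'y)).
Qed.

(** The rule for the Christoffel symbols is differentiated in the direction [a].
    All that does not behave like a tensor is collected in the last summand,
    which is symmetric in [a] and [b]. *)
Lemma curvature_half_change y a b c : U y ->
  'D_('D_a (fun z => christoffel_map G z b c) y
      + christoffel_map G y a (christoffel_map G y b c)) psi y =
  'D_('D_a psi y) (fun x => christoffel_map G' x ('D_b psi y) ('D_c psi y)) (psi y)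
  + christoffel_map G' (psi y) ('D_a psi y)
      (christoffel_map G' (psi y) ('D_b psi y) ('D_c psi y))
  + ('D_a ('D_b ('D_c psi)) y
     + christoffel_map G' (psi y) ('D_a ('D_b psi) y) ('D_c psi y)
     + (christoffel_map G' (psi y) ('D_a psi y) ('D_b ('D_c psi) y)
        + christoffel_map G' (psi y) ('D_b psi y) ('D_a ('D_c psi) y))).
Proof.
move=> Uy; have U'y := psiU Uy.
have npsi := nearU (fun z Uz => dpsi Uz) Uy.
have E1 := @derive_moving_id _ _ _ psi (fun z => christoffel_map G z b c)
  y a (differentiable_christoffel_map mG b c Uy) npsi (fun w => dpsi1 w Uy).
have [d2 E2] := derive_christoffel_map mG' a U'y (dpsi Uy) (dpsi1 b Uy) (dpsi1 c Uy).
have E3 : 'D_a (fun z => 'D_(christoffel_map G z b c) psi z) y =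
    'D_a (fun z => 'D_b ('D_c psi) z
      + christoffel_map G' (psi z) ('D_b psi z) ('D_c psi z)) y.
  by apply: near_eq_derive; apply: (nearU _ Uy) => z; exact: christoffel_change.
have d1 : differentiable ('D_b ('D_c psi)) y.
  exact: (smooth_differentiable (smooth_derive b (smooth_derive c spsi)) Uy).
have E4 := deriveD (diff_derivable (v:=a) d1) (diff_derivable (v:=a) d2).
have E5 := christoffel_change a (christoffel_map G y b c) Uy.
rewrite (christoffel_change b c Uy) christoffel_mapDr in E5.
have E6 := etrans (etrans (esym E1) E3) E4.
apply: (etrans (derive_dirD _ _ (dpsi Uy))).
apply: (etrans (congr1 (+%R _) E5)).
apply: curvature_algebra.
exact: (etrans E6 (congr1 (+%R _) E2)).
Qed.

(** The curvature is the difference of two expressions as in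
    [curvature_half_change], with [u] and [v] exchanged, and the symmetric
    summands cancel. *)
Lemma curvature_change y u v w : U y ->
  'D_(curvature_at G y u v w) psi y =
  curvature_at G' (psi y) ('D_u psi y) ('D_v psi y) ('D_w psi y).
Proof.
move=> Uy; rewrite !curvature_atE.
apply: (etrans (derive_dirB _ _ (dpsi Uy))).
rewrite (curvature_half_change u v w Uy) (curvature_half_change v u w Uy).
apply: antisym_algebra.
  exact: (schwarz u v oU (smooth_derive w spsi 2) Uy).
exact: (congr1 (fun t => christoffel_map G' (psi y) t ('D_w psi y))
  (schwarz u v oU (spsi 2) Uy)).
Qed.

End change_of_coordinates.

Lemma derive2_comp (R : realType) (V : normedModType R) k l
    (U : set V) (W : set 'rV[R]_k) (f : V -> 'rV[R]_k) (g : 'rV[R]_k -> 'rV[R]_l)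
    (x u v : V) :
  open U -> open W -> smooth_on U f -> smooth_on W g ->
  (forall z, U z -> W (f z)) -> U x ->
  'D_u ('D_v (g \o f)) x =
  'D_('D_u f x) ('D_('D_v f x) g) (f x) + 'D_('D_u ('D_v f) x) g (f x).
Proof.
move=> oU oW sf sg fW Ux.
have E : 'D_u ('D_v (g \o f)) x = 'D_u (fun z => 'D_('D_v f z) g (f z)) x.
  apply: near_eq_derive; apply: filterS (open_nbhs_nbhs (conj oU Ux)) => z Uz.
  exact: (derive_comp v (smooth_differentiable sf Uz)
    (smooth_differentiable sg (fW z Uz))).
apply: (etrans E).
have ng : \forall z \near x, differentiable g (f z).
  apply: filterS (open_nbhs_nbhs (conj oU Ux)) => z Uz.
  exact: (smooth_differentiable sg (fW z Uz)).
have [_ E'] := @derive_moving _ _ _ _ g f ('D_v f) x u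
  (smooth_differentiable sf Ux) (smooth_differentiable (smooth_derive v sf) Ux)
  ng (smooth_differentiable_near oW sg (fW x Ux))
  (fun w => smooth_differentiable (smooth_derive w sg) (fW x Ux)).
exact: E'.
Qed.

Lemma sff_algebra (R : realType) n (F F2 P2 S X GX D B : 'rV[R]_n) :
  F + X = P2 + F2 -> B = P2 + S -> D = X + GX ->
  F2 + B - D = F + S - GX.
Proof.
move=> /rowP H -> ->; apply/rowP => i; move: (H i); rewrite !mxE; lra.
Qed.

Section second_fundamental_form_change.
Context (R : realType) (m n : nat).

Definition sff (G : 'rV[R]_m -> 'M[R]_m) (H : 'rV[R]_n -> 'M[R]_n)
    (f : 'rV[R]_m -> 'rV[R]_n) (u v y : 'rV[R]_m) : 'rV[R]_n :=
  'D_u ('D_v f) y + christoffel_map H (f y) ('D_u f y) ('D_v f y)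
  - 'D_(christoffel_map G y u v) f y.

Lemma second_fundamental_formE G H f u v y :
  second_fundamental_form G H f (fun=> u) (fun=> v) y = sff G H f u v y.
Proof.
rewrite /second_fundamental_form /pullback_connection /levi_civita /sff.
apply: (congr1 (fun t => _ - 'D_t f y)).
by apply: (etrans (congr1 (+%R^~ _) (derive_cst v y u))); rewrite add0r.
Qed.

Variables (U U' : set 'rV[R]_m) (G G' : 'rV[R]_m -> 'M[R]_m).
Variables (W W' : set 'rV[R]_n) (H H' : 'rV[R]_n -> 'M[R]_n).
Variables (chi : 'rV[R]_m -> 'rV[R]_m) (psi : 'rV[R]_n -> 'rV[R]_n).
Hypotheses (mG : coord_metric U G) (mG' : coord_metric U' G').
Hypotheses (mH : coord_metric W H) (mH' : coord_metric W' H').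
Hypotheses (schi : smooth_on U chi) (chiU : forall y, U y -> U' (chi y)).
Hypotheses (spsi : smooth_on W psi) (psiW : forall y, W y -> W' (psi y)).
Hypothesis isochi : forall y u v, U y ->
  inner (G y) u v = inner (G' (chi y)) ('D_u chi y) ('D_v chi y).
Hypothesis isopsi : forall y u v, W y ->
  inner (H y) u v = inner (H' (psi y)) ('D_u psi y) ('D_v psi y).
Variables (f f' : 'rV[R]_m -> 'rV[R]_n).
Hypotheses (sf : smooth_on U f) (fW : forall y, U y -> W (f y)).
Hypothesis sf' : smooth_on U' f'.
Hypothesis ff' : forall y, U y -> f' (chi y) = psi (f y).

Let oU : open U. Proof. by case: mG. Qed.
Let oU' : open U'. Proof. by case: mG'. Qed.
Let oW : open W. Proof. by case: mH. Qed.
Let nff' y : U y -> \forall z \near y, (f' \o chi) z = (psi \o f) z.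
Proof.
by move=> Uy; apply: filterS (open_nbhs_nbhs (conj oU Uy)) => z /ff'.
Qed.
Let df y : U y -> differentiable f y. Proof. exact: smooth_differentiable. Qed.
Let df' y : U' y -> differentiable f' y. Proof. exact: smooth_differentiable. Qed.
Let dchi y : U y -> differentiable chi y. Proof. exact: smooth_differentiable. Qed.
Let dpsi y : W y -> differentiable psi y. Proof. exact: smooth_differentiable. Qed.

Lemma derive_map_change y u : U y ->
  'D_('D_u chi y) f' (chi y) = 'D_('D_u f y) psi (f y).
Proof.
move=> Uy.
apply: (etrans (esym (derive_comp u (dchi Uy) (df' (chiU Uy))))).
apply: (etrans (near_eq_derive u (nff' Uy))).
exact: (derive_comp u (df Uy) (dpsi (fW Uy))).
Qed.

(** The equality of [f' \o chi] with [psi \o f] is differentiated twice.  The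
    second derivatives of [chi] and [psi] that appear are those by which the
    Christoffel symbols of the two metrics fail to be tensors. *)
Lemma sff_change y u v : U y ->
  sff G' H' f' ('D_u chi y) ('D_v chi y) (chi y) =
  'D_(sff G H f u v y) psi (f y).
Proof.
move=> Uy; rewrite /sff.
have C1 := derive2_comp u v oU oU' schi sf' chiU Uy.
have C2 := derive2_comp u v oU oW sf spsi fW Uy.
have C3 : 'D_u ('D_v (f' \o chi)) y = 'D_u ('D_v (psi \o f)) y.
  apply: near_eq_derive; apply: filterS (open_nbhs_nbhs (conj oU Uy)) => z Uz.
  exact: (near_eq_derive v (nff' Uz)).
have C := etrans (etrans (esym C1) C3) C2.
have N := christoffel_change mH mH' spsi psiW isopsi ('D_u f y) ('D_v f y) (fW Uy).
have M := christoffel_change mG mG' schi chiU isochi u v Uy.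
have K := derive_map_change (christoffel_map G y u v) Uy.
have K1 := etrans (congr1 (fun t => 'D_t f' (chi y)) M)
  (derive_dirD _ _ (df' (chiU Uy))).
rewrite -(derive_map_change u Uy) -(derive_map_change v Uy) -(ff' Uy) in N.
apply: esym; apply: (etrans (derive_dirB _ _ (dpsi (fW Uy)))).
apply: (etrans (congr1 (+%R^~ _) (derive_dirD _ _ (dpsi (fW Uy))))).
apply: (sff_algebra C N (etrans (esym K) K1)).
Qed.

End second_fundamental_form_change.

(** * Orthonormal frames *)

Section orthonormal_frames.
Context (R : realType).

Lemma schur_block n (a : 'M[R]_1) (b : 'M[R]_(1, n)) (D : 'M[R]_n) (c : R) :
  c = a 0 0 -> c != 0 ->
  let L : 'M[R]_(1 + n) := block_mx 1%:M 0 (- (c^-1 *: b^T)) 1%:M in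
  L *m block_mx a b b^T D *m L^T =
  block_mx a 0 0 (D - c^-1 *: (b^T *m b)).
Proof.
move=> ca c0 L; have aE : a = c%:M by rewrite ca; exact: mx11_scalar.
rewrite /L tr_block_mx !mulmx_block !mul1mx !mul0mx !addr0 !trmx1 !mulmx1.
rewrite trmx0 mulmx0 addr0 aE.
have E1 : - (c^-1 *: b^T) *m c%:M + b^T = 0.
  by rewrite mul_mx_scalar scalerN scalerA divff// scale1r addNr.
have E2 : c%:M *m (- (c^-1 *: b^T))^T + b = 0.
  rewrite mul_scalar_mx linearN linearZ /= trmxK.
  by rewrite scalerN scalerA divff// scale1r addNr.
rewrite !E1 E2 mul0mx mulmx0 !add0r.
by rewrite mulNmx -scalemxAl addrC.
Qed.

(** By induction on the dimension: one step of Gaussian elimination splits off a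
    positive number, and leaves the Schur complement, which is again symmetric
    and positive definite. *)
Lemma orthonormal_basis_exists n (G : 'M[R]_n) : G^T = G ->
  (forall v, v != 0 -> 0 < inner G v v) ->
  exists E : 'M[R]_n, E *m G *m E^T = 1%:M.
Proof.
elim: n G => [|n IH] G GT pG.
  by exists 1%:M; apply/matrixP => -[].
move: G GT pG; rewrite -[n.+1]/(1 + n)%N => G GT pG.
set a := ulsubmx G; set b := ursubmx G; set D := drsubmx G.
have GE : G = block_mx a b b^T D.
  rewrite -[LHS]submxK; congr block_mx.
  by rewrite /b trmx_ursub GT.
pose c := a 0 0.
have c0 : 0 < c.
  have := pG (row_mx 1%:M 0).
  rewrite /inner GE mul_row_block !mul1mx !mul0mx !addr0.
  rewrite tr_row_mx mul_row_col trmx1 mulmx1 trmx0 mulmx0 addr0; apply.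
  apply/eqP => /rowP /(_ (lshift n 0)); rewrite row_mxEl !mxE.
  by move/eqP; rewrite oner_eq0.
have cn0 : c != 0 by rewrite gt_eqF.
have := @schur_block n a b D c erefl cn0; rewrite -GE.
set L := block_mx _ _ _ _; set S := D - _ => LE.
have inL (u : 'rV[R]_(1 + n)) : inner G (u *m L) (u *m L) = inner (L *m G *m L^T) u u.
  by rewrite inner_mul.
have [E' E'S] : exists E : 'M[R]_n, E *m S *m E^T = 1%:M.
  apply: IH.
    rewrite /S linearB linearZ /= trmx_mul trmxK; congr (_ - _).
    by rewrite /D trmx_drsub GT.
  move=> w w0; have : 0 < inner G (row_mx 0 w *m L) (row_mx 0 w *m L).
    apply: pG; apply: contra w0 => /eqP.
    rewrite /L mul_row_block mul0mx add0r mulmx0 mulmx1 add0r => /eqP.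
    by rewrite row_mx_eq0 => /andP[].
  rewrite inL LE /inner mul_row_block !mul0mx !mulmx0 !addr0 add0r.
  by rewrite tr_row_mx mul_row_col trmx0 mul0mx add0r.
pose F : 'M[R]_(1 + n) := block_mx ((Num.sqrt c)^-1)%:M 0 0 E'.
exists (F *m L).
have -> : F *m L *m G *m (F *m L)^T = F *m (L *m G *m L^T) *m F^T.
  by rewrite trmx_mul !mulmxA.
rewrite LE /F tr_block_mx !mulmx_block !trmx0 !mul0mx !mulmx0.
rewrite !addr0 !add0r E'S [RHS]scalar_mx_block.
congr block_mx; rewrite ?mul0mx//.
rewrite [a]mx11_scalar -/c tr_scalar_mx -!scalar_mxM; congr (_%:M).
have s0 : Num.sqrt c != 0 by rewrite sqrtr_eq0 -ltNge.
by rewrite -[X in _ * X / _](sqr_sqrtr (ltW c0)) expr2; field.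
Qed.

(** As an orthonormal basis exists, [frame] is one, and not its default value. *)
Lemma frameP n (G : 'M[R]_n) : G^T = G ->
  (forall v, v != 0 -> 0 < inner G v v) ->
  frame G *m G *m (frame G)^T = 1%:M.
Proof.
move=> GT pG; have [E EG] := orthonormal_basis_exists GT pG.
exact: (@xgetPex _ 1%:M [set E | E *m G *m E^T = 1%:M] (ex_intro _ E EG)).
Qed.

Lemma orthonormal_gram n (G E : 'M[R]_n) : G \in unitmx ->
  E *m G *m E^T = 1%:M -> E^T *m E = invmx G.
Proof.
move=> uG; rewrite -mulmxA => /mulmx1C; rewrite -mulmxA => EG.
by rewrite -[LHS](mulKmx uG) EG mulmx1.
Qed.

End orthonormal_frames.

Section traces.
Context (R : realType) (n : nat).

Lemma linear_coordE (T : lmodType R) (f : 'rV[R]_n -> T) v :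
  linear f -> f v = \sum_a v 0 a *: f (delta_mx 0 a).
Proof.
move=> lf; pose F : {linear 'rV[R]_n -> T} :=
  HB.pack f (GRing.isLinear.Build _ _ _ _ f lf).
rewrite [in LHS](row_sum_delta v) -[f]/(F : _ -> _) linear_sum.
by apply: eq_bigr => i _; rewrite linearZ.
Qed.

(** The trace only sees [E^T *m E], which is the inverse of the metric when the
    rows of [E] are orthonormal ([orthonormal_gram]).  It is thus independent of
    the orthonormal basis, and of the way in which one is selected at each
    point. *)
Lemma bilinear_trace (T : lmodType R) (Q : 'rV[R]_n -> 'rV[R]_n -> T) (E : 'M[R]_n) :
  (forall u, linear (Q u)) -> (forall v, linear (Q^~ v)) ->
  \sum_i Q (row i E) (row i E) =
  \sum_a \sum_b (E^T *m E) a b *: Q (delta_mx 0 a) (delta_mx 0 b).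
Proof.
move=> lQ lQ'.
transitivity (\sum_i \sum_a \sum_b
    (E i a * E i b) *: Q (delta_mx 0 a) (delta_mx 0 b)).
  apply: eq_bigr => i _; rewrite (linear_coordE (row i E) (lQ' (row i E))).
  apply: eq_bigr => a _; rewrite (linear_coordE (row i E) (lQ _)) scaler_sumr.
  by apply: eq_bigr => b _; rewrite !mxE scalerA.
rewrite exchange_big /=; apply: eq_bigr => a _.
rewrite exchange_big /=; apply: eq_bigr => b _.
rewrite mxE scaler_suml; apply: eq_bigr => i _.
by rewrite mxE.
Qed.

End traces.

(** * The curvature density in coordinates *)

Section multilinearity.
Context (R : realType) (n : nat).
Variables (U : set 'rV[R]_n) (G : 'rV[R]_n -> 'M[R]_n).
Hypothesis mG : coord_metric U G.

Lemma christoffel_linearl y v : linear (fun u => christoffel_map G y u v).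
Proof. by move=> a u u'; rewrite christoffel_mapDl christoffel_mapZl. Qed.

Lemma christoffel_linearr y u : linear (christoffel_map G y u).
Proof. by move=> a v v'; rewrite christoffel_mapDr christoffel_mapZr. Qed.

(** The curvature is this expression antisymmetrised in [u] and [v]. *)
Definition curvature_half y u v w : 'rV[R]_n :=
  'D_u (fun z => christoffel_map G z v w) y
  + christoffel_map G y u (christoffel_map G y v w).

Lemma linear_derive (F : 'rV[R]_n -> 'rV[R]_n -> 'rV[R]_n) u y :
  (forall v, differentiable (F v) y) ->
  (forall z, linear (F^~ z)) -> linear (fun v => 'D_u (F v) y).
Proof.
move=> dF lF a v w.
have -> : F (a *: v + w) = a *: F v + F w.
  by apply/funext => z; exact: lF.
apply: (etrans (deriveD _ _)); try by apply: diff_derivable; try apply: differentiableZ; exact: dF.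
by apply: (congr1 (+%R^~ _)); apply: deriveZ; exact: diff_derivable.
Qed.

Lemma linear_add (T : lmodType R) (f g : 'rV[R]_n -> T) :
  linear f -> linear g -> linear (fun v => f v + g v).
Proof. by move=> lf lg a u v; rewrite lf lg scalerDr addrACA. Qed.

Lemma linear_sub (T : lmodType R) (f g : 'rV[R]_n -> T) :
  linear f -> linear g -> linear (fun v => f v - g v).
Proof. by move=> lf lg a u v; rewrite lf lg scalerBr opprD addrACA. Qed.

Lemma curvature_half_linear1 y v w : U y -> linear (fun u => curvature_half y u v w).
Proof.
move=> Uy; apply: linear_add; last exact: christoffel_linearl.
by move=> a u u'; exact: (derive_linear a u u' (differentiable_christoffel_map mG v w Uy)).
Qed.

Lemma curvature_half_linear2 y u w : U y -> linear (fun v => curvature_half y u v w).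
Proof.
move=> Uy; apply: linear_add.
  apply: (@linear_derive (fun v z => christoffel_map G z v w)) => [v|z].
    exact: (differentiable_christoffel_map mG).
  exact: christoffel_linearl.
by move=> a v v'; rewrite (christoffel_linearl _ _ a) (christoffel_linearr _ _ a).
Qed.

Lemma curvature_half_linear3 y u v : U y -> linear (curvature_half y u v).
Proof.
move=> Uy; apply: linear_add.
  apply: (@linear_derive (fun w z => christoffel_map G z v w)) => [w|z].
    exact: (differentiable_christoffel_map mG).
  exact: christoffel_linearr.
by move=> a w w'; rewrite !(christoffel_linearr _ _ a).
Qed.

Lemma curvature_linear1 y v w : U y -> linear (fun u => curvature_at G y u v w).
Proof.
move=> Uy a u u'; rewrite !curvature_atE.
exact: (linear_sub (curvature_half_linear1 v w Uy) (curvature_half_linear2 v w Uy)).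
Qed.

Lemma curvature_linear2 y u w : U y -> linear (fun v => curvature_at G y u v w).
Proof.
move=> Uy a v v'; rewrite !curvature_atE.
exact: (linear_sub (curvature_half_linear2 u w Uy) (curvature_half_linear1 u w Uy)).
Qed.

Lemma curvature_linear3 y u v : U y -> linear (curvature_at G y u v).
Proof.
move=> Uy a w w'; rewrite !curvature_atE.
exact: (linear_sub (curvature_half_linear3 u v Uy) (curvature_half_linear3 v u Uy)).
Qed.

End multilinearity.

Section density.
Context (R : realType) (m n : nat).

(** The density in coordinates.  The basis is a parameter, so that bases that are
    orthonormal for the same metric can be compared. *)
Definition frame_density (G : 'rV[R]_m -> 'M[R]_m) (H : 'rV[R]_n -> 'M[R]_n)
    (f : 'rV[R]_m -> 'rV[R]_n) (y : 'rV[R]_m) (E : 'M[R]_m) : R :=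
  \sum_i \sum_j
    let W := curvature_at H (f y) ('D_(row i E) f y) ('D_(row j E) f y)
               (tension G H f y) in
    inner (H (f y)) W W.

Variables (U : set 'rV[R]_m) (G : 'rV[R]_m -> 'M[R]_m).
Variables (W : set 'rV[R]_n) (H : 'rV[R]_n -> 'M[R]_n).
Variable f : 'rV[R]_m -> 'rV[R]_n.
Hypotheses (mG : coord_metric U G) (mH : coord_metric W H).
Hypotheses (sf : smooth_on U f) (fW : forall y, U y -> W (f y)).

Let oU : open U. Proof. by case: mG. Qed.

Lemma sff_linear1 y v : U y -> linear (fun u => sff G H f u v y).
Proof.
move=> Uy; have df := smooth_differentiable sf Uy.
have df1 := smooth_differentiable (smooth_derive v sf) Uy.
apply: linear_sub; first apply: linear_add.
- by move=> a u u'; exact: (derive_linear a u u' df1).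
- move=> a u u'.
  apply: (etrans (congr1 (fun t => christoffel_map H (f y) t _) (derive_linear a u u' df))).
  exact: christoffel_linearl.
- move=> a u u'.
  apply: (etrans (congr1 (fun t => 'D_t f y) (christoffel_linearl _ _ _ a u u'))).
  exact: (derive_linear a _ _ df).
Qed.

Lemma sff_linear2 y u : U y -> linear (fun v => sff G H f u v y).
Proof.
move=> Uy; have df := smooth_differentiable sf Uy.
have df1 v := smooth_differentiable (smooth_derive v sf) Uy.
apply: linear_sub; first apply: linear_add.
- move=> a v v'.
  have E : 'D_u ('D_(a *: v + v') f) y = 'D_u (a *: 'D_v f + 'D_v' f) y.
    apply: near_eq_derive; apply: filterS (open_nbhs_nbhs (conj oU Uy)) => z Uz.
    exact: (derive_linear a v v' (smooth_differentiable sf Uz)).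
  apply: (etrans E).
  have d1 := diff_derivable (v:=u) (df1 v').
  have d2 := diff_derivable (v:=u) (df1 v).
  have d3 := derivableZ (k:=a) d2.
  apply: (etrans (deriveD d3 d1)).
  exact: (congr1 (+%R^~ _) (deriveZ a d2)).
- move=> a v v'.
  apply: (etrans (congr1 (christoffel_map H (f y) _) (derive_linear a v v' df))).
  exact: christoffel_linearr.
- move=> a v v'.
  apply: (etrans (congr1 (fun t => 'D_t f y) (christoffel_linearr _ _ _ a v v'))).
  exact: (derive_linear a _ _ df).
Qed.

Definition metric_trace (T : lmodType R) (P : 'M[R]_m)
    (Q : 'rV[R]_m -> 'rV[R]_m -> T) : T :=
  \sum_a \sum_b P a b *: Q (delta_mx 0 a) (delta_mx 0 b).

Lemma metric_frame y : U y ->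
  frame (G y) *m G y *m (frame (G y))^T = 1%:M.
Proof.
by move=> Uy; case: mG => _ _ tG pG; apply: frameP; [exact: tG|exact: pG].
Qed.

Lemma sff_trace y (E : 'M[R]_m) : U y -> E *m G y *m E^T = 1%:M ->
  \sum_i sff G H f (row i E) (row i E) y =
  metric_trace (invmx (G y)) (fun u v => sff G H f u v y).
Proof.
move=> Uy EG; rewrite -(orthonormal_gram (coord_metric_unitmx mG Uy) EG).
apply: bilinear_trace => u; first exact: sff_linear2.
exact: sff_linear1.
Qed.

Lemma tension_trace y : U y -> tension G H f y =
  metric_trace (invmx (G y)) (fun u v => sff G H f u v y).
Proof.
move=> Uy; rewrite -(sff_trace Uy (metric_frame Uy)).
by apply: eq_bigr => i _; exact: second_fundamental_formE.
Qed.

(** Two traces of bilinear forms, one for each index of the frame.  The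
    right-hand side does not involve [E], and depends smoothly on [y]. *)
Lemma frame_density_trace y (E : 'M[R]_m) : U y -> E *m G y *m E^T = 1%:M ->
  frame_density G H f y E =
  @metric_trace R^o (invmx (G y)) (fun u u' =>
    @metric_trace R^o (invmx (G y)) (fun v v' =>
      inner (H (f y))
       (curvature_at H (f y) ('D_u f y) ('D_v f y) (tension G H f y))
       (curvature_at H (f y) ('D_u' f y) ('D_v' f y) (tension G H f y)))).
Proof.
move=> Uy EG; set t := tension _ _ _ _.
have df := smooth_differentiable sf Uy.
pose C u v := curvature_at H (f y) ('D_u f y) ('D_v f y) t.
have C1 v : linear (C^~ v).
  move=> a u u'; apply: (etrans (congr1 (fun s => curvature_at H (f y) s _ t)
    (derive_linear a u u' df))).
  exact: (curvature_linear1 mH _ _ (fW Uy)).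
have C2 u : linear (C u).
  move=> a v v'; apply: (etrans (congr1 (fun s => curvature_at H (f y) _ s t)
    (derive_linear a v v' df))).
  exact: (curvature_linear2 mH _ _ (fW Uy)).
have gE := orthonormal_gram (coord_metric_unitmx mG Uy) EG.
pose Q u u' : R^o := \sum_j inner (H (f y)) (C u (row j E)) (C u' (row j E)).
have lQ u : linear (Q u).
  move=> a v v'; rewrite /Q scaler_sumr -big_split; apply: eq_bigr => j _.
  by rewrite C1 innerDr innerZr.
have lQ' u : linear (Q^~ u).
  move=> a v v'; rewrite /Q scaler_sumr -big_split; apply: eq_bigr => j _.
  by rewrite C1 innerDl innerZl.
rewrite -[LHS]/(\sum_i Q (row i E) (row i E)).
rewrite (bilinear_trace E lQ lQ') gE.
apply: eq_bigr => a _; apply: eq_bigr => b _; congr (_ *: _).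
rewrite /Q (@bilinear_trace _ _ R^o (fun v v' => inner (H (f y))
  (C (delta_mx 0 a) v) (C (delta_mx 0 b) v')) E) ?gE// => u c v v'.
- by rewrite C2 innerDr innerZr.
- by rewrite C2 innerDl innerZl.
Qed.

Definition coord_density y := frame_density G H f y (frame (G y)).

Lemma coord_density_frame y (E : 'M[R]_m) : U y -> E *m G y *m E^T = 1%:M ->
  coord_density y = frame_density G H f y E.
Proof.
move=> Uy EG; rewrite (frame_density_trace Uy EG).
by rewrite -(frame_density_trace Uy (metric_frame Uy)).
Qed.

End density.

Lemma mulmx_frame_inner (R : realType) n (G E : 'M[R]_n) i j :
  (E *m G *m E^T) i j = inner G (row i E) (row j E).
Proof.
rewrite /inner -row_mul !mxE; apply: eq_bigr => k _.
by rewrite !mxE.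
Qed.

Section density_change.
Context (R : realType) (m n : nat).
Variables (U U' : set 'rV[R]_m) (G G' : 'rV[R]_m -> 'M[R]_m).
Variables (W W' : set 'rV[R]_n) (H H' : 'rV[R]_n -> 'M[R]_n).
Variables (chi : 'rV[R]_m -> 'rV[R]_m) (psi : 'rV[R]_n -> 'rV[R]_n).
Hypotheses (mG : coord_metric U G) (mG' : coord_metric U' G').
Hypotheses (mH : coord_metric W H) (mH' : coord_metric W' H').
Hypotheses (schi : smooth_on U chi) (chiU : forall y, U y -> U' (chi y)).
Hypotheses (spsi : smooth_on W psi) (psiW : forall y, W y -> W' (psi y)).
Hypothesis isochi : forall y u v, U y ->
  inner (G y) u v = inner (G' (chi y)) ('D_u chi y) ('D_v chi y).
Hypothesis isopsi : forall y u v, W y ->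
  inner (H y) u v = inner (H' (psi y)) ('D_u psi y) ('D_v psi y).
Variables (f f' : 'rV[R]_m -> 'rV[R]_n).
Hypotheses (sf : smooth_on U f) (fW : forall y, U y -> W (f y)).
Hypotheses (sf' : smooth_on U' f') (fW' : forall y, U' y -> W' (f' y)).
Hypothesis ff' : forall y, U y -> f' (chi y) = psi (f y).
Variable y : 'rV[R]_m.
Hypothesis Uy : U y.

Let E := frame (G y).
Let E' := E *m jacobian chi y.

Let rowE' i : row i E' = 'D_(row i E) chi y.
Proof.
by rewrite row_mul (deriveEjacobian _ (smooth_differentiable schi Uy)).
Qed.

Let E'G' : E' *m G' (chi y) *m E'^T = 1%:M.
Proof.
apply/matrixP => i j; rewrite mulmx_frame_inner !rowE' -(isochi _ _ Uy).
by rewrite -mulmx_frame_inner (metric_frame mG Uy).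
Qed.

Lemma tension_change :
  tension G' H' f' (chi y) = 'D_(tension G H f y) psi (f y).
Proof.
rewrite (tension_trace H' mG' sf' (chiU Uy)) (tension_trace H mG sf Uy).
rewrite -(sff_trace H' mG' sf' (chiU Uy) E'G').
rewrite -(sff_trace H mG sf Uy (metric_frame mG Uy)).
have dpsi := smooth_differentiable spsi (fW Uy).
rewrite (deriveE _ dpsi) linear_sum; apply: eq_bigr => i _.
rewrite -(deriveE _ dpsi) !rowE'.
exact: (sff_change mG mG' mH mH' schi chiU spsi psiW isochi isopsi sf fW sf').
Qed.

(** The differential of [chi] takes an orthonormal basis to an orthonormal
    basis, and the one of [psi] is an isometry that carries the tension and the
    curvature to the tension and the curvature. *)
Lemma coord_density_change :
  coord_density G' H' f' (chi y) = coord_density G H f y.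
Proof.
rewrite (coord_density_frame mG' mH' sf' fW' (chiU Uy) E'G').
rewrite /coord_density -/E /frame_density.
apply: eq_bigr => i _; apply: eq_bigr => j _.
rewrite !rowE' tension_change.
have D u := derive_map_change mG schi chiU spsi sf fW sf' ff' u Uy.
have C := curvature_change mH mH' spsi psiW isopsi ('D_(row i E) f y)
  ('D_(row j E) f y) (tension G H f y) (fW Uy).
have E4 q q1 q2 t : q = psi (f y) -> q1 = 'D_('D_(row i E) f y) psi (f y) ->
    q2 = 'D_('D_(row j E) f y) psi (f y) ->
    curvature_at H' q q1 q2 t = curvature_at H' (psi (f y))
      ('D_('D_(row i E) f y) psi (f y)) ('D_('D_(row j E) f y) psi (f y)) t.
  by move=> -> -> ->.
have E5 := etrans (E4 _ _ _ _ (ff' Uy) (D (row i E)) (D (row j E))) (esym C).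
apply: (etrans (congr2 (inner (H' (f' (chi y)))) E5 E5)).
apply: (etrans (congr1 (fun q => inner (H' q) _ _) (ff' Uy))).
exact: (esym (isopsi _ _ (fW Uy))).
Qed.

End density_change.

(** * Smooth dependence on time *)

Section slices.
Context (R : realType) (m : nat).

Lemma derive_slice (W : normedModType R) (F : R * 'rV[R]_m -> W) (t : R)
    (v y : 'rV[R]_m) :
  'D_v (fun z => F (t, z)) y = 'D_((0, v) : R * 'rV[R]_m) F (t, y).
Proof.
rewrite /derive.
have -> : (fun h : R => h^-1 *:
      (((fun z => F (t, z)) \o shift y) (h *: v) - F (t, y))) =
    (fun h : R => h^-1 *:
      ((F \o shift (t, y)) (h *: ((0, v) : R * 'rV[R]_m)) - F (t, y))).
  apply/funext => s /=; congr (_ *: (F _ - _)).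
  change ((t, s *: v + y) = (s *: (0 : R) + t, s *: v + y)).
  by rewrite scaler0 add0r.
by [].
Qed.

Lemma derive_sliceE (W : normedModType R) (F : R * 'rV[R]_m -> W) (t : R)
    (v : 'rV[R]_m) :
  'D_v (fun z => F (t, z)) = fun z => 'D_((0, v) : R * 'rV[R]_m) F (t, z).
Proof. by apply/funext => y; exact: derive_slice. Qed.

Lemma differentiable_pairl (t : R) (y : 'rV[R]_m) :
  differentiable (fun z : 'rV[R]_m => (t, z)) y.
Proof.
exact: (differentiable_pair (differentiable_cst t y)
  (ex_diff : differentiable id y)).
Qed.

Lemma differentiable_slice (W : normedModType R) (F : R * 'rV[R]_m -> W) (t : R)
    (y : 'rV[R]_m) :
  differentiable F (t, y) -> differentiable (fun z => F (t, z)) y.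
Proof.
move=> dF.
exact: (@differentiable_comp _ _ _ _ (fun z : 'rV[R]_m => (t, z)) F y
  (differentiable_pairl t y) dF).
Qed.

Lemma Ck_slice (W : normedModType R) k (O : set (R * 'rV[R]_m)) (F : R * 'rV[R]_m -> W)
    (t : R) : Ck k O F -> Ck k [set y | O (t, y)] (fun y => F (t, y)).
Proof.
elim: k F => [|k IH] F.
  move=> cF y Oy.
  exact: (@continuous_comp _ _ _ (fun z : 'rV[R]_m => (t, z)) F y
    (differentiable_continuous (differentiable_pairl t y)) (cF _ Oy)).
move=> [dF cF]; split => [y Oy|v]; first exact: (differentiable_slice (dF _ Oy)).
by rewrite derive_sliceE; exact: (IH _ (cF _)).
Qed.

Lemma open_slice (O : set (R * 'rV[R]_m)) t : open O -> open [set y | O (t, y)].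
Proof.
move=> oO; rewrite -[X in open X]/((fun y : 'rV[R]_m => (t, y)) @^-1` O).
apply: open_comp => // y _.
exact: (differentiable_continuous (differentiable_pairl t y)).
Qed.

Lemma Ck_snd k (O : set (R * 'rV[R]_m)) : Ck k O (fun ty => ty.2).
Proof.
pose S : {linear (R * 'rV[R]_m)%type -> 'rV[R]_m} := snd.
apply: (@Ck_linear _ _ _ k O S).
by move=> x; exact: cvg_snd.
Qed.

End slices.

Section joint_density.
Context (R : realType) (m n : nat).
Variables (U : set 'rV[R]_m) (G : 'rV[R]_m -> 'M[R]_m).
Variables (W : set 'rV[R]_n) (H : 'rV[R]_n -> 'M[R]_n).
Hypotheses (mG : coord_metric U G) (mH : coord_metric W H).
Variables (O : set (R * 'rV[R]_m)) (F : R * 'rV[R]_m -> 'rV[R]_n).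
Hypotheses (oO : open O) (sF : smooth_on O F).
Hypotheses (OU : forall ty, O ty -> U ty.2) (OW : forall ty, O ty -> W (F ty)).

Let oU : open U. Proof. by case: mG. Qed.
Let oW : open W. Proof. by case: mH. Qed.

Lemma coord_metric_sub U' : open U' -> U' `<=` U -> coord_metric U' G.
Proof.
move=> oU' sub; case: mG => _ sG tG pG; split=> // [a b k|y /sub|y /sub].
- exact: (Ck_sub sub (sG a b k)).
- exact: tG.
- exact: pG.
Qed.

Let slice_metric t : coord_metric [set y | O (t, y)] G.
Proof.
by apply: coord_metric_sub; [exact: open_slice|move=> y /= /OU].
Qed.

Let slice_smooth t : smooth_on [set y | O (t, y)] (fun y => F (t, y)).
Proof. by move=> k; exact: Ck_slice. Qed.

Section order.
Variable k : nat.
Implicit Types X Y Z : R * 'rV[R]_m -> 'rV[R]_n.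

Let Ck_source (q : 'rV[R]_m -> R) : Ck k U q -> Ck k O (fun ty => q ty.2).
Proof.
move=> cq; exact: (Ck_comp oO oU OU (Ck_snd k O) cq).
Qed.

Let Ck_target (q : 'rV[R]_n -> R) : Ck k W q -> Ck k O (fun ty => q (F ty)).
Proof. by move=> cq; exact: (Ck_comp oO oW OW (sF k) cq). Qed.

Let Ck_inner_comp (T : R * 'rV[R]_m -> 'M[R]_n) X Y :
  (forall i j, Ck k O (fun ty => T ty i j)) -> Ck k O X -> Ck k O Y ->
  Ck k O (fun ty => inner (T ty) (X ty) (Y ty)).
Proof.
move=> cT cX cY.
have c1 : Ck k O (fun ty => \sum_i \sum_j X ty 0 i * T ty i j * Y ty 0 j).
  apply: Ck_sum => // i; apply: Ck_sum => // j; apply: CkM => //.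
    by apply: CkM => //; exact: Ck_entry.
  exact: Ck_entry.
by apply: (Ck_ext oO _ c1) => ty _; rewrite innerE.
Qed.

Let Ck_scale (c : R * 'rV[R]_m -> R) X : Ck k O c -> Ck k O X ->
  Ck k O (fun ty => c ty *: X ty).
Proof.
move=> cc cX; apply/Ck_rowP => // i.
apply: (Ck_ext oO _ (CkM oO cc (Ck_entry i oO cX))) => ty _.
by rewrite mxE.
Qed.

Let Ck_christoffel_comp X Y : Ck k O X -> Ck k O Y ->
  Ck k O (fun ty => christoffel_map H (F ty) (X ty) (Y ty)).
Proof.
move=> cX cY; apply/Ck_rowP => // c.
have c1 : Ck k O (fun ty => inner (christoffel_form H c (F ty)) (X ty) (Y ty)).
  apply: Ck_inner_comp => // i j.
  have := Ck_target (smooth_christoffel mH i j c k).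
  by apply: Ck_ext => // ty _; rewrite mxE.
by apply: (Ck_ext oO _ c1) => ty _; rewrite christoffel_mapE.
Qed.

Lemma Ck_christoffel_map_moving j (u : 'rV[R]_n) (v : 'rV[R]_n -> 'rV[R]_n) : Ck j W v ->
  Ck j W (fun z => christoffel_map H z u (v z)).
Proof.
move=> cv; apply/Ck_rowP => // c.
have c1 : Ck j W (fun z => \sum_a \sum_b christoffel H z a b c * u 0 a * v z 0 b).
  apply: Ck_sum => // a; apply: Ck_sum => // b.
  apply: CkM => //; last exact: Ck_entry.
  by apply: CkM => //; [exact: smooth_christoffel|exact: Ck_cst].
by apply: (Ck_ext oW _ c1) => z _; rewrite mxE.
Qed.

Lemma Ck_christoffel_map j (u v : 'rV[R]_n) :
  Ck j W (fun z => christoffel_map H z u v).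
Proof. exact: (Ck_christoffel_map_moving u (Ck_cst j W v)). Qed.

Lemma Ck_curvature_cst (u v w : 'rV[R]_n) : Ck k W (fun z => curvature_at H z u v w).
Proof.
have half a b : Ck k W (fun z => 'D_a (fun x => christoffel_map H x b w) z
    + christoffel_map H z a (christoffel_map H z b w)).
  apply: CkD => //; first exact: (Ck_derive a (Ck_christoffel_map k.+1 b w)).
  by apply: Ck_christoffel_map_moving; exact: Ck_christoffel_map.
by apply: (Ck_ext oW _ (CkB oW (half u v) (half v u))) => z _; rewrite curvature_atE.
Qed.

Let Ck_curvature_comp X Y Z : Ck k O X -> Ck k O Y -> Ck k O Z ->
  Ck k O (fun ty => curvature_at H (F ty) (X ty) (Y ty) (Z ty)).
Proof.
move=> cX cY cZ.
pose e (i : 'I_n) : 'rV[R]_n := delta_mx 0 i.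
have ce i j l : Ck k O (fun ty => curvature_at H (F ty) (e i) (e j) (e l)).
  apply/Ck_rowP => // c.
  exact: (Ck_target (Ck_entry c oW (Ck_curvature_cst (e i) (e j) (e l)))).
have c1 : Ck k O (fun ty => \sum_i X ty 0 i *: \sum_j Y ty 0 j *:
    \sum_l Z ty 0 l *: curvature_at H (F ty) (e i) (e j) (e l)).
  apply: Ck_sum => // i; apply: Ck_scale; first exact: Ck_entry.
  apply: Ck_sum => // j; apply: Ck_scale; first exact: Ck_entry.
  apply: Ck_sum => // l; apply: Ck_scale; first exact: Ck_entry.
  exact: ce.
apply: (Ck_ext oO _ c1) => ty Oty; have Wty := OW Oty.
rewrite (linear_coordE (X ty) (curvature_linear1 mH _ _ Wty)).
apply: eq_bigr => i _; congr (_ *: _).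
rewrite (linear_coordE (Y ty) (curvature_linear2 mH _ _ Wty)).
apply: eq_bigr => j _; congr (_ *: _).
by rewrite (linear_coordE (Z ty) (curvature_linear3 mH _ _ Wty)).
Qed.

Let dF (v : 'rV[R]_m) := 'D_((0, v) : R * 'rV[R]_m) F.

Let CkdF v : Ck k O (dF v).
Proof. exact: (Ck_derive _ (sF k.+1)). Qed.

Let cinv a b : Ck k O (fun ty => invmx (G ty.2) a b).
Proof.
apply: (Ck_source (q := fun y => invmx (G y) a b)); apply: Ck_invmx => //.
  by move=> y; exact: coord_metric_unitmx.
by case: mG => _ sG _ _ i j; exact: sG.
Qed.

Lemma Ck_tension :
  Ck k O (fun ty => tension G H (fun y => F (ty.1, y)) ty.2).
Proof.
pose e (i : 'I_m) : 'rV[R]_m := delta_mx 0 i.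
have cs a b : Ck k O (fun ty =>
    'D_((0, e a) : R * 'rV[R]_m) (dF (e b)) ty
    + christoffel_map H (F ty) (dF (e a) ty) (dF (e b) ty)
    - \sum_c (christoffel_map G ty.2 (e a) (e b)) 0 c *: dF (e c) ty).
  apply: CkB => //; first apply: CkD => //.
  - exact: (Ck_derive _ (Ck_derive _ (sF k.+2))).
  - exact: Ck_christoffel_comp.
  - apply: Ck_sum => // c; apply: Ck_scale => //.
    apply: (Ck_source (q := fun y => (christoffel_map G y (e a) (e b)) 0 c)).
    have c1 : Ck k U (fun z => \sum_i \sum_j christoffel G z i j c * e a 0 i * e b 0 j).
      apply: Ck_sum => // i; apply: Ck_sum => // j.
      apply: CkM => //; last exact: Ck_cst.
      by apply: CkM => //; [exact: smooth_christoffel|exact: Ck_cst].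
    by apply: (Ck_ext oU _ c1) => z _; rewrite mxE.
have c1 : Ck k O (fun ty => \sum_a \sum_b invmx (G ty.2) a b *:
    ('D_((0, e a) : R * 'rV[R]_m) (dF (e b)) ty
    + christoffel_map H (F ty) (dF (e a) ty) (dF (e b) ty)
    - \sum_c (christoffel_map G ty.2 (e a) (e b)) 0 c *: dF (e c) ty)).
  by apply: Ck_sum => // a; apply: Ck_sum => // b; apply: Ck_scale.
apply: (Ck_ext oO _ c1) => -[t y] Oty /=.
rewrite (tension_trace H (slice_metric t) (slice_smooth t) Oty).
apply: eq_bigr => a _; apply: eq_bigr => b _; apply: (congr1 ( *:%R _)).
have E1 w := derive_slice F t w y.
have E2 : 'D_(e a) ('D_(e b) (fun z => F (t, z))) y =
    'D_((0, e a) : R * 'rV[R]_m) (dF (e b)) (t, y).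
  exact: (etrans (congr1 (fun g => 'D_(e a) g y) (derive_sliceE F t (e b)))
    (derive_slice (dF (e b)) t (e a) y)).
have E3 : 'D_(christoffel_map G y (e a) (e b)) (fun z => F (t, z)) y =
    \sum_c (christoffel_map G y (e a) (e b)) 0 c *: dF (e c) (t, y).
  apply: (etrans (derive_coordE _ (smooth_differentiable (slice_smooth t) Oty))).
  by apply: eq_bigr => c _; apply: (congr1 ( *:%R _)); exact: E1.
apply: esym; apply: (congr2 (fun p q => p - q) _ E3).
exact: (congr2 +%R E2 (congr2 (christoffel_map H (F (t, y))) (E1 _) (E1 _))).
Qed.

(** The frame of [coord_density] is chosen anew at each point.  It is eliminated
    by [frame_density_trace], which leaves sums of products of derivatives of
    [F] and of quantities derived from the metrics. *)
Lemma Ck_coord_density :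
  Ck k O (fun ty => coord_density G H (fun y => F (ty.1, y)) ty.2).
Proof.
pose e (i : 'I_m) : 'rV[R]_m := delta_mx 0 i.
pose C a c ty := curvature_at H (F ty) (dF (e a) ty) (dF (e c) ty)
  (tension G H (fun y => F (ty.1, y)) ty.2).
have cC a c : Ck k O (C a c) by apply: Ck_curvature_comp => //; exact: Ck_tension.
have c1 : Ck k O (fun ty => \sum_a \sum_b invmx (G ty.2) a b *
    \sum_c \sum_d invmx (G ty.2) c d * inner (H (F ty)) (C a c ty) (C b d ty)).
  apply: Ck_sum => // a; apply: Ck_sum => // b; apply: CkM => //.
  apply: Ck_sum => // c; apply: Ck_sum => // d; apply: CkM => //.
  apply: Ck_inner_comp => // i j.
  by case: mH => _ sH _ _; exact: (Ck_target (sH i j k)).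
apply: (Ck_ext oO _ c1) => -[t y] Oty.
rewrite /coord_density.
rewrite (frame_density_trace (slice_metric t) mH (slice_smooth t)
  (fun y Oy => OW Oy) Oty (metric_frame (slice_metric t) Oty)).
apply: eq_bigr => a _; apply: eq_bigr => b _; apply: (congr1 ( *%R _)).
apply: eq_bigr => c _; apply: eq_bigr => d _; apply: (congr1 ( *%R _)).
have E1 w := derive_slice F t w y.
pose tau := tension G H (fun z => F (t, z)) y.
have E2 u v := congr2 (fun p q => curvature_at H (F (t, y)) p q tau) (E1 u) (E1 v).
exact: (esym (congr2 (inner (H (F (t, y)))) (E2 _ _) (E2 _ _))).
Qed.

End order.
End joint_density.

(** * The curvature density on a manifold *)

Section charts.
Context (R : realType) (m : nat) (M : smoothManifold R m).
Implicit Types (i j : atlas M) (p q : M).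

Lemma open_chart_image i (A : set M) :
  open A -> open (chart_map i @` (dom i `&` A)).
Proof.
move=> oA; rewrite openE => _ [p [ip Ap] <-].
have yim : (chart_map i @` dom i) (chart_map i p) by exists p.
have n1 := open_nbhs_nbhs (conj (@open_chart_map_dom _ _ M i) yim).
have n2 : \forall z \near chart_map i p, A (param i z).
  have := param_continuous_on yim; apply.
  by rewrite /= chart_mapK//; exact: open_nbhs_nbhs.
apply: filterS2 n1 n2 => z [q iq <-]; rewrite chart_mapK// => Aq.
by exists q.
Qed.

Variable g : riemannianMetric M.

Lemma chart_coord_metric i : coord_metric (chart_map i @` dom i) (g i).
Proof.
split.
- exact: open_chart_map_dom.
- exact: (metric_smooth g i).
- by move=> y Uy; exact: (Defs.metric_sym g Uy).
- by move=> y Uy; exact: (Defs.metric_pos g Uy).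
Qed.

Lemma chart_coord_metric_sub i (A : set M) : open A -> A `<=` dom i ->
  coord_metric (chart_map i @` A) (g i).
Proof.
move=> oA Ai; apply: (coord_metric_sub (chart_coord_metric i)).
  by rewrite -(setIidr Ai); exact: open_chart_image.
exact: image_subset.
Qed.

Lemma transition_isometry i j y (u v : 'rV[R]_m) :
  (chart_map i @` (dom i `&` dom j)) y ->
  let chi := chart_map j \o param i in
  inner (g i y) u v = inner (g j (chi y)) ('D_u chi y) ('D_v chi y).
Proof.
move=> Uy chi; have dchi := smooth_differentiable (@transition_smooth _ _ M i j) Uy.
rewrite (metric_transition g Uy) inner_mul.
by rewrite -(deriveEjacobian u dchi) -(deriveEjacobian v dchi).
Qed.

End charts.

Section scalar_density.
Context (R : realType) (m n : nat).
Variables (M : smoothManifold R m) (N : smoothManifold R n).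
Variables (g : riemannianMetric M) (h : riemannianMetric N).
Implicit Types (phi : M -> N) (p : M).

Lemma ES4_density_local phi p :
  ES4_density g h phi p =
  coord_density (g (chart_at p)) (h (chart_at (phi p))) (local_rep phi p)
    (chart_map (chart_at p) p).
Proof.
have E : local_rep phi p (chart_map (chart_at p) p) =
    chart_map (chart_at (phi p)) (phi p).
  by rewrite /local_rep /= chart_mapK//; exact: dom_chart_at.
by rewrite /coord_density /frame_density E.
Qed.

(** The charts selected at [p] and at its image may jump as [p] moves.  By
    invariance, one fixed pair of charts serves for all points near [p]. *)
Lemma ES4_density_chart phi (i : atlas M) (j : atlas N) p :
  smooth_map phi -> dom i p -> dom j (phi p) ->
  ES4_density g h phi p =
  coord_density (g i) (h j) (chart_map j \o phi \o param i) (chart_map i p).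
Proof.
move=> [cphi sphi] ip jp; rewrite ES4_density_local.
set i0 := chart_at p; set j0 := chart_at (phi p).
pose B : set N := dom j0 `&` dom j.
have oB : open B by apply: openI; exact: open_dom.
pose A : set M := (dom i0 `&` dom i) `&` phi @^-1` B.
have oA : open A.
  apply: openI; first by apply: openI; exact: open_dom.
  by apply: open_comp => // q _; exact: cphi.
have Ai0 : A `<=` dom i0 by move=> q [[]].
have Ai : A `<=` dom i by move=> q [[]].
have AB q : A q -> B (phi q) by case.
have Ap : A p by split; split => //; exact: dom_chart_at.
have Bj0 : B `<=` dom j0 by move=> q [].
have Bj : B `<=` dom j by move=> q [].
have mG := chart_coord_metric_sub g oA Ai0.
have mG' := chart_coord_metric_sub g oA Ai.
have mH := chart_coord_metric_sub h oB Bj0.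
have mH' := chart_coord_metric_sub h oB Bj.
pose chi := chart_map i \o param i0; pose psi := chart_map j \o param j0.
have sub1 : chart_map i0 @` A `<=` chart_map i0 @` (dom i0 `&` dom i).
  by apply: image_subset => q [].
have schi : smooth_on (chart_map i0 @` A) chi.
  by move=> k; exact: (Ck_sub sub1 (@transition_smooth _ _ M _ _ k)).
have spsi : smooth_on (chart_map j0 @` B) psi.
  exact: transition_smooth.
have chiE q : dom i0 q -> chi (chart_map i0 q) = chart_map i q.
  by move=> iq; rewrite /chi /= chart_mapK.
have psiE q : dom j0 q -> psi (chart_map j0 q) = chart_map j q.
  by move=> jq; rewrite /psi /= chart_mapK.
have chiU y : (chart_map i0 @` A) y -> (chart_map i @` A) (chi y).
  by move=> [q Aq <-]; rewrite chiE; [exists q|exact: Ai0].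
have psiW y : (chart_map j0 @` B) y -> (chart_map j @` B) (psi y).
  by move=> [q Bq <-]; rewrite psiE; [exists q|exact: Bj0].
have repU i' j' : A `<=` dom i' -> B `<=` dom j' ->
    [/\ smooth_on (chart_map i' @` A) (chart_map j' \o phi \o param i') &
    forall q, A q -> (chart_map j' \o phi \o param i') (chart_map i' q) =
      chart_map j' (phi q)].
  move=> sA sB; split => [k|q Aq]; last by rewrite /= chart_mapK//; exact: sA.
  apply: Ck_sub (sphi i' j' k) => _ [q Aq <-]; split; first by exists q => //; exact: sA.
  by rewrite /= chart_mapK; [exact/sB/AB|exact: sA].
have [sf fE] := repU i0 j0 Ai0 Bj0.
have [sf' fE'] := repU i j Ai Bj.
apply: esym; rewrite -(chiE p (Ai0 _ Ap)).
apply: (coord_density_change (psi := psi) mG mG' mH mH' schi chiU spsi psiW _ _ sf _ sf').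
- by move=> y u v Uy; exact/transition_isometry/sub1.
- by move=> y u v Wy; exact/transition_isometry.
- by move=> _ [q Aq <-]; rewrite fE//; exists (phi q) => //; exact: AB.
- by move=> _ [q Aq <-]; rewrite fE'//; exists (phi q) => //; exact: AB.
- move=> _ [q Aq <-]; rewrite chiE; last exact: Ai0.
  by rewrite fE// fE'// psiE//; exact/Bj0/AB.
- by exists p.
Qed.

Lemma curvature_at0 l (H : 'rV[R]_l -> 'M[R]_l) (y u v : 'rV[R]_l) :
  curvature_at H y u v 0 = 0.
Proof.
rewrite curvature_atE.
have E w : (fun z => christoffel_map H z w 0) = fun=> 0.
  by apply/funext => z; exact: christoffel_map0r.
rewrite !E !christoffel_map0r.
by rewrite (derive_cst 0 y u) (derive_cst 0 y v) subrr.
Qed.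

Lemma ES4_density_eq0 phi p : tension_field g h phi p = 0 ->
  ES4_density g h phi p = 0.
Proof.
move=> t0; rewrite /ES4_density big1// => i _; rewrite big1// => j _.
by rewrite t0 /curvature_tensor curvature_at0 /metric_at /inner mul0mx mul0mx mxE.
Qed.

Lemma ES4_density_ge0 phi p : 0 <= ES4_density g h phi p.
Proof.
apply: sumr_ge0 => i _; apply: sumr_ge0 => j _ /=.
set w := curvature_tensor _ _ _ _ _.
have [->|w0] := eqVneq w 0; first by rewrite /metric_at /inner mul0mx mul0mx mxE.
apply/ltW; apply: metric_pos w0; exists (phi p) => //; exact: dom_chart_at.
Qed.

Lemma tension_near l k (G : 'rV[R]_l -> 'M[R]_l) (H : 'rV[R]_k -> 'M[R]_k)
    (f1 f2 : 'rV[R]_l -> 'rV[R]_k) y :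
  (\forall z \near y, f1 z = f2 z) -> tension G H f1 y = tension G H f2 y.
Proof.
move=> f12; apply: eq_bigr => i _.
rewrite !second_fundamental_formE /sff.
have E w : \forall z \near y, 'D_w f1 z = 'D_w f2 z.
  have := nbhs_interior f12; apply: filterS => z nz; exact: near_eq_derive.
have E1 w := nbhs_singleton (E w).
apply: (congr2 (fun p q : 'rV[R]_k => p - q) _ (E1 _)).
apply: (congr2 (fun p q : 'rV[R]_k => p + q) (near_eq_derive _ (E _))).
rewrite (nbhs_singleton f12).
exact: (congr2 (christoffel_map H (f2 y)) (E1 _) (E1 _)).
Qed.

Lemma tension_field_near phi1 phi2 p : (\forall q \near p, phi1 q = phi2 q) ->
  tension_field g h phi1 p = tension_field g h phi2 p.
Proof.
move=> E; rewrite /tension_field /local_rep (nbhs_singleton E).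
apply: tension_near.
have ip := dom_chart_at p.
have yim : (chart_map (chart_at p) @` dom (chart_at p)) (chart_map (chart_at p) p).
  by exists p.
have n1 : nbhs (param (chart_at p) (chart_map (chart_at p) p))
    (fun q => phi1 q = phi2 q) by rewrite chart_mapK.
have n2 : \forall z \near chart_map (chart_at p) p,
    phi1 (param (chart_at p) z) = phi2 (param (chart_at p) z).
  exact: (param_continuous_on yim n1).
apply: filterS n2 => z E'.
exact: (congr1 (chart_map (chart_at (phi2 p))) E').
Qed.

End scalar_density.

(** * Regularity in time along a variation *)

Lemma continuous_time (R : realType) (S T : topologicalType) (f : S -> T)
    (t : R) (y : S) : {for y, continuous f} ->
  {for (t, y), continuous (fun ty : R * S => (ty.1, f ty.2))}.
Proof.
move=> cf.
have c1 : {for (t, y), continuous (fun ty : R * S => ty.1)} by exact: cvg_fst.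
have c2 : {for (t, y), continuous (fun ty : R * S => ty.2)} by exact: cvg_snd.
have c3 := @continuous_comp _ _ _ (fun ty : R * S => ty.2) f (t, y) c2 cf.
exact: (@cvg_pair _ _ _ _ (nbhs t) (nbhs (f y)) _ _ _ _ _ c1 c3).
Qed.

Section time_slices.
Context (R : realType) (m : nat).

Lemma is_derive_time (D : R * 'rV[R]_m -> R) (t : R) (y : 'rV[R]_m) :
  differentiable D (t, y) ->
  is_derive t 1 (fun s => D (s, y)) ('D_((1, 0) : R * 'rV[R]_m) D (t, y)).
Proof.
move=> dD.
have E s : s *: ((1, 0) : R * 'rV[R]_m) + (0, y) = (s, y).
  change ((s *: (1 : R) + 0, s *: (0 : 'rV[R]_m) + y) = (s, y)).
  by rewrite scaler0 add0r addr0 /GRing.scale/= mulr1.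
have := @is_derive_line R _ _ D (1, 0) (0, y) t.
rewrite E => /(_ dD).
have -> : (fun s : R => D (s *: ((1, 0) : R * 'rV[R]_m) + (0, y))) =
          (fun s => D (s, y)) by apply/funext => s; rewrite E.
exact.
Qed.

Variables (M : smoothManifold R m) (i : atlas M).
Variables (O : set (R * 'rV[R]_m)) (D : R * 'rV[R]_m -> R) (u : R -> M -> R).
Hypotheses (oO : open O) (sD : smooth_on O D).
Hypothesis uD : forall t p, dom i p -> O (t, chart_map i p) ->
  u t p = D (t, chart_map i p).

Lemma chart_time_derive t p : dom i p -> O (t, chart_map i p) ->
  is_derive t 1 (u^~ p) ('D_((1, 0) : R * 'rV[R]_m) D (t, chart_map i p)).
Proof.
move=> ip Op.
have nO : \forall s \near t, O (s, chart_map i p).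
  have c : {for t, continuous (fun s : R => (s, chart_map i p))}.
    apply: differentiable_continuous.
    exact: (differentiable_pair (ex_diff : differentiable id t)
      (differentiable_cst (chart_map i p) t)).
  by have := c _ (open_nbhs_nbhs (conj oO Op)).
apply: near_eq_is_derive (is_derive_time (smooth_differentiable sD Op)).
by apply: filterS nO => s Os; rewrite uD.
Qed.

Lemma chart_continuous t p : dom i p -> O (t, chart_map i p) ->
  {for p, continuous (u t)}.
Proof.
move=> ip Op.
have c : {for p, continuous (fun q => (t, chart_map i q))}.
  apply: (@continuous_comp _ _ _ (chart_map i) (fun z : 'rV[R]_m => (t, z))).
    exact: chart_map_continuous_on.
  exact: (differentiable_continuous (differentiable_pairl t _)).
have cD : {for p, continuous (D \o (fun q => (t, chart_map i q)))}.
  apply: (continuous_comp c).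
  exact: (differentiable_continuous (smooth_differentiable sD Op)).
have nO : \forall q \near p, dom i q /\ O (t, chart_map i q).
  apply: filterI; first exact: open_nbhs_nbhs (conj (open_dom i) ip).
  by have := c _ (open_nbhs_nbhs (conj oO Op)).
change (u t q @[q --> p] --> u t p); rewrite (uD ip Op).
apply: cvg_trans cD; apply: near_eq_cvg.
by apply: filterS nO => q [iq Oq]; rewrite /= uD.
Qed.

Lemma chart_time_partial t p : dom i p -> O (t, chart_map i p) ->
  partial1of2 u t p = 'D_((1, 0) : R * 'rV[R]_m) D (t, chart_map i p).
Proof.
move=> ip Op; rewrite partial1of2E.
exact: (@derive_val _ _ _ _ _ _ _ (chart_time_derive ip Op)).
Qed.

Lemma smooth_locally_bounded ty : O ty ->
  exists C, \forall z \near ty, `|D z| <= C.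
Proof.
move=> Oty; exists (`|D ty| + 1).
have c := differentiable_continuous (smooth_differentiable sD Oty).
have /cvgrPdist_lt /(_ 1 ltr01) := c; apply: filterS => z lt1.
rewrite addrC -lerBlDr; apply: ltW; apply: le_lt_trans lt1.
by rewrite distrC; exact: lerB_dist.
Qed.

End time_slices.

(** What is asked of the integrand in order to differentiate twice under the
    integral: the bounds give the domination, and the continuity in space gives
    the measurability. *)
Definition regular (R : realType) (M : topologicalType) (u : R -> M -> R)
    (C t : R) (p : M) : Prop :=
  [/\ derivable (u^~ p) t 1, derivable (partial1of2 u ^~ p) t 1,
      [/\ `|u t p| <= C, `|partial1of2 u t p| <= C &
          `|partial1of2 (partial1of2 u) t p| <= C],
      {for p, continuous (u t)} & {for p, continuous (partial1of2 u t)}].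

Lemma regular_le (R : realType) (M : topologicalType) (u : R -> M -> R)
  (C C' t : R) (p : M) : C <= C' -> regular u C t p -> regular u C' t p.
Proof.
move=> CC [d0 d1 [b0 b1 b2] c0 c1]; split => //.
by split; exact: le_trans CC.
Qed.

Lemma regular_of_derivatives (R : realType) m (M : smoothManifold R m)
    (i : atlas M) (O : set (R * 'rV[R]_m)) (D D1 D2 : R * 'rV[R]_m -> R)
    (u : R -> M -> R) (p0 : M) :
  open O -> smooth_on O D -> smooth_on O D1 -> smooth_on O D2 ->
  (forall t p, dom i p -> O (t, chart_map i p) -> u t p = D (t, chart_map i p)) ->
  (forall t p, dom i p -> O (t, chart_map i p) ->
     partial1of2 u t p = D1 (t, chart_map i p)) ->
  (forall t p, dom i p -> O (t, chart_map i p) ->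
     partial1of2 (partial1of2 u) t p = D2 (t, chart_map i p)) ->
  dom i p0 -> O (0, chart_map i p0) ->
  exists C : R, \forall tp \near ((0 : R), p0), regular u C tp.1 tp.2.
Proof.
move=> oO sD sD1 sD2 E0 E1 E2 ip0 O0.
have [C0 b0] := smooth_locally_bounded sD O0.
have [C1 b1] := smooth_locally_bounded sD1 O0.
have [C2 b2] := smooth_locally_bounded sD2 O0.
have nO := open_nbhs_nbhs (conj oO O0).
have nb : \forall z \near ((0 : R), chart_map i p0), O z /\
    (`|D z| <= C0 /\ (`|D1 z| <= C1 /\ `|D2 z| <= C2)).
  exact: filterI nO (filterI b0 (filterI b1 b2)).
have c : {for ((0 : R), p0), continuous (fun tp : R * M => (tp.1, chart_map i tp.2))}.
  exact: (@continuous_time R _ _ (chart_map i) 0 p0 (chart_map_continuous_on ip0)).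
have ni : \forall tp \near ((0 : R), p0), dom i tp.2.
  have c2 : {for ((0 : R), p0), continuous (fun tp : R * M => tp.2)} by exact: cvg_snd.
  exact: (c2 _ (open_nbhs_nbhs (conj (open_dom i) ip0))).
exists (Num.max C0 (Num.max C1 C2)).
apply: filterS2 ni (c _ nb) => -[t p] /= ip [Op [h0 [h1 h2]]].
split.
- exact: (@ex_derive _ _ _ _ _ _ _ (chart_time_derive oO sD E0 ip Op)).
- exact: (@ex_derive _ _ _ _ _ _ _ (chart_time_derive oO sD1 E1 ip Op)).
- rewrite (E0 t p ip Op) (E1 t p ip Op) (E2 t p ip Op); split.
  + by rewrite le_max h0.
  + by rewrite !le_max h1 orbT.
  + by rewrite !le_max h2 !orbT.
- exact: (@chart_continuous R m M i O D u oO sD E0 t p ip Op).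
- exact: (@chart_continuous R m M i O D1 _ oO sD1 E1 t p ip Op).
Qed.

(** The time derivatives of [u] are those of its local expression [D], which
    are smooth, hence bounded near a point. *)
Lemma chart_regular (R : realType) m (M : smoothManifold R m) (i : atlas M)
    (O : set (R * 'rV[R]_m)) (D : R * 'rV[R]_m -> R) (u : R -> M -> R) (p0 : M) :
  open O -> smooth_on O D ->
  (forall t p, dom i p -> O (t, chart_map i p) -> u t p = D (t, chart_map i p)) ->
  dom i p0 -> O (0, chart_map i p0) ->
  exists C : R, \forall tp \near ((0 : R), p0), regular u C tp.1 tp.2.
Proof.
move=> oO sD E0 ip0 O0.
have sD1 := smooth_derive ((1, 0) : R * 'rV[R]_m) sD.
have sD2 := smooth_derive ((1, 0) : R * 'rV[R]_m) sD1.
have E1 := chart_time_partial oO sD E0.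
have E2 := chart_time_partial oO sD1 E1.
exact: (regular_of_derivatives oO sD sD1 sD2 E0 E1 E2 ip0 O0).
Qed.

Section variation.
Context (R : realType) (m n : nat).
Variables (M : smoothManifold R m) (N : smoothManifold R n).
Variables (g : riemannianMetric M) (h : riemannianMetric N).
Variables (Phi : R -> M -> N) (e : R).
Hypothesis e0 : 0 < e.
Hypothesis cPhi : forall (t : R) (p : M), `|t| < e ->
  {for (t, p), continuous (fun tp : R * M => Phi tp.1 tp.2)}.

Definition variation_dom (i : atlas M) (j : atlas N) : set (R * 'rV[R]_m) :=
  [set ty : R * 'rV[R]_m | [/\ `|ty.1| < e, (chart_map i @` dom i) ty.2 &
     dom j (Phi ty.1 (param i ty.2))]].

Hypothesis sPhi : forall (i : atlas M) (j : atlas N),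
  smooth_on (variation_dom i j)
    (fun ty => chart_map j (Phi ty.1 (param i ty.2))).

Lemma open_variation_dom i j : open (variation_dom i j).
Proof.
rewrite openE => -[t y] [/= te yi jp].
have n1 : \forall ty \near (t, y), `|ty.1| < e.
  have c : {for (t, y), continuous (fun ty : R * 'rV[R]_m => `|ty.1|)}.
    by apply: cvg_norm; exact: cvg_fst.
  have ne : nbhs `|t| [set x : R | x < e].
    by apply: open_nbhs_nbhs; split => //; exact: open_lt.
  exact: (c _ ne).
have n2 : \forall ty \near (t, y), (chart_map i @` dom i) ty.2.
  have c : {for (t, y), continuous (fun ty : R * 'rV[R]_m => ty.2)}.
    exact: cvg_snd.
  exact: (c _ (open_nbhs_nbhs (conj (@open_chart_map_dom _ _ M i) yi))).
have n3 : \forall ty \near (t, y), dom j (Phi ty.1 (param i ty.2)).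
  have c : {for (t, y), continuous (fun ty : R * 'rV[R]_m => (ty.1, param i ty.2))}.
    exact: (@continuous_time R _ _ (param i) t y (param_continuous_on yi)).
  have c' := continuous_comp c (cPhi (p := param i y) te).
  exact: (c' _ (open_nbhs_nbhs (conj (open_dom j) jp))).
by apply: filterS3 n1 n2 n3 => ty; split.
Qed.

Lemma variation_smooth_map t : `|t| < e -> smooth_map (Phi t).
Proof.
move=> te; split => [p|i j k].
  have c : {for p, continuous (fun q : M => (t, q))}.
    exact: (@cvg_pair _ _ _ _ (nbhs t) (nbhs p) _ _ _ (fun=> t) id
      (cvg_cst t) cvg_id).
  exact: (continuous_comp c (cPhi (p := p) te)).
apply: Ck_sub (Ck_slice t (sPhi i j k)) => y [yi jy].
by split.
Qed.

Definition density_along (t : R) (p : M) : R := ES4_density g h (Phi t) p.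

Definition chart_density i j (ty : R * 'rV[R]_m) : R :=
  coord_density (g i) (h j) (fun y => chart_map j (Phi ty.1 (param i y))) ty.2.

Lemma chart_density_smooth i j : smooth_on (variation_dom i j) (chart_density i j).
Proof.
move=> k.
apply: (@Ck_coord_density _ _ _ _ _ _ _ (chart_coord_metric g i)
  (chart_coord_metric h j) (variation_dom i j)
  (fun ty => chart_map j (Phi ty.1 (param i ty.2)))).
- exact: open_variation_dom.
- exact: sPhi.
- by move=> ty [].
- by move=> ty [_ _ jp]; exists (Phi ty.1 (param i ty.2)).
Qed.

Lemma chart_densityE i j t p : dom i p -> variation_dom i j (t, chart_map i p) ->
  density_along t p = chart_density i j (t, chart_map i p).
Proof.
move=> ip [te _ jp].
have {}jp : dom j (Phi t p).
  exact: (eq_ind _ (fun q => dom j (Phi t q)) jp _ (chart_mapK ip)).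
exact: (ES4_density_chart g h (variation_smooth_map te) ip jp).
Qed.

Lemma density_regular_near (p0 : M) : exists C : R,
  \forall tp \near ((0 : R), p0), regular density_along C tp.1 tp.2.
Proof.
pose i := chart_at p0; pose j := chart_at (Phi 0 p0).
have O0 : variation_dom i j (0, chart_map i p0).
  split; first by rewrite normr0.
    by exists p0 => //; exact: dom_chart_at.
  by rewrite /= chart_mapK; exact: dom_chart_at.
have oO : open (variation_dom i j) by exact: open_variation_dom.
have sD : smooth_on (variation_dom i j) (chart_density i j).
  exact: chart_density_smooth.
exact: (chart_regular oO sD (@chart_densityE i j) (dom_chart_at p0) O0).
Qed.

End variation.

(** * Integrals depending on a parameter *)

Section nonmeasurable_monotonicity.
Local Open Scope ereal_scope.

(** The integral of a nonnegative function is a supremum over the simple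
    functions below it.  In this form, monotonicity applies to the inner
    integrals of an iterated integral. *)
Lemma ge0_le_integralT d (T : measurableType d) (R : realType)
    (mu : {measure set T -> \bar R}) (f1 f2 : T -> \bar R) :
  (forall x, 0 <= f1 x) -> (forall x, f1 x <= f2 x) ->
  \int[mu]_(x in [set: T]) f1 x <= \int[mu]_(x in [set: T]) f2 x.
Proof.
move=> f10 f12; have f20 x : 0 <= f2 x := le_trans (f10 x) (f12 x).
rewrite !ge0_integralTE//; apply: le_ereal_sup => _ [g gf <-].
by exists g => // x; exact: le_trans (gf x) (f12 x).
Qed.

End nonmeasurable_monotonicity.

Section rV_integral_bound.
Context (R : realType).

(** One coordinate at a time: a function bounded by [c] and supported in an
    interval of length [r *+ 2] has an integral of at most [c * (r *+ 2)]. *)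
Lemma rV_integral_box n (f : 'rV[R]_n -> \bar R) (y0 : 'rV[R]_n) (c r : R) :
  0 <= c -> 0 < r -> (forall v, (0 <= f v)%E) -> (forall v, (f v <= c%:E)%E) ->
  (forall (v : 'rV[R]_n) i, r <= `|y0 0 i - v 0 i| -> f v = 0%E) ->
  (0 <= rV_integral f)%E /\ (rV_integral f <= (c * (r *+ 2) ^+ n)%:E)%E.
Proof.
elim: n f y0 c => [|n IH] f y0 c c0 r0 f0 fc fbox.
  by rewrite /= expr0 mulr1; split.
pose F (x : R) := rV_integral (fun v : 'rV[R]_n =>
  f (row_mx (x%:M : 'rV[R]_1) v : 'rV[R]_n.+1)).
pose y1 : 'rV[R]_n := \row_j y0 0 (lift ord0 j).
have tail x (v : 'rV[R]_n) j :
    (row_mx (x%:M : 'rV[R]_1) v : 'rV[R]_n.+1) 0 (lift ord0 j) = v 0 j.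
  by have := row_mxEr (x%:M : 'rV[R]_1) v 0 j; rewrite rshift1.
have head x (v : 'rV[R]_n) :
    (row_mx (x%:M : 'rV[R]_1) v : 'rV[R]_n.+1) 0 ord0 = x.
  have := row_mxEl (x%:M : 'rV[R]_1) v 0 ord0.
  rewrite [RHS]mxE eqxx mulr1n => {2}<-.
  by congr (row_mx _ _ _ _); exact: val_inj.
have FB x d : 0 <= d -> (forall v, (f (row_mx (x%:M : 'rV[R]_1) v : 'rV[R]_n.+1) <= d%:E)%E) ->
    (0 <= F x)%E /\ (F x <= (d * (r *+ 2) ^+ n)%:E)%E.
  move=> d0 fd; apply: (IH _ y1) => // v j rj.
  by apply: (fbox _ (lift ord0 j)); rewrite tail; move: rj; rewrite mxE.
have F0 x : (0 <= F x)%E by have [] := FB x c c0 (fun v => fc _).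
pose k := c * (r *+ 2) ^+ n.
have k0 : 0 <= k by rewrite mulr_ge0// exprn_ge0// mulrn_wge0// ltW.
pose B : set R := ball (y0 0 ord0) r.
have mB : measurable B by exact: measurable_ball.
have FkB x : (F x <= (k * \1_B x)%:E)%E.
  rewrite indicE; have [xB|xB] := boolP (x \in B).
    by rewrite mulr1; have [] := FB x c c0 (fun v => fc _).
  rewrite mulr0; have : (F x <= (0 * (r *+ 2) ^+ n)%:E)%E.
    apply: (FB x 0 _ _).2 => // v; rewrite (fbox _ ord0)// head.
    move: xB; rewrite notin_setE /B -ball_normE /ball_ /= => /negP.
    by rewrite -leNgt.
  by rewrite mul0r.
split; first by apply: integral_ge0 => x _; exact: F0.
apply: (@le_trans _ _ (\int[lebesgue_measure]_(x in [set: R]) (k * \1_B x)%:E)%E).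
  exact: ge0_le_integralT.
have -> : (\int[lebesgue_measure]_(x in [set: R]) (k * \1_B x)%:E =
    k%:E * \int[lebesgue_measure]_(x in [set: R]) (\1_B x)%:E)%E.
  have H := @ge0_integralZl_EFin _ _ R lebesgue_measure [set: R] measurableT
    (fun x => (\1_B x)%:E).
  have H1 x : [set: R] x -> (0 <= (\1_B x)%:E :> \bar R)%E by rewrite lee_fin.
  have H2 : measurable_fun [set: R] (fun x => (\1_B x)%:E : \bar R).
    exact/measurable_EFinP/measurable_indic.
  exact: (H H1 H2 k k0).
rewrite integral_indic// setIT.
rewrite [X in (_ * X <= _)%E](_ : _ = (r *+ 2)%:E); last first.
  exact: (lebesgue_measure_ball _ (ltW r0)).
by rewrite -EFinM /k -mulrA -exprSr.
Qed.

End rV_integral_bound.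

Section parametric_integral.
Context (R : realType) d (T : measurableType d) (mu : {measure set T -> \bar R}).
Variables (u : R -> T -> R) (K : set T) (C e : R).
Hypotheses (mK : measurable K) (muK : (mu K < +oo)%E).

Lemma integrable_scaled_indic (k : R) :
  mu.-integrable [set: T] (EFin \o (fun p => k * \1_K p)).
Proof.
have iK : mu.-integrable [set: T] (fun p => (\1_K p)%:E).
  apply/integrableP; split; first exact/measurable_EFinP/measurable_indic.
  rewrite (eq_integral (fun x => (\1_K x)%:E)); last first.
    by move=> t _; rewrite gee0_abs// lee_fin.
  by rewrite integral_indic// setIT.
have := integrableZl measurableT k iK.
by apply: eq_integrable => // p _ /=; rewrite EFinM.
Qed.

Lemma integrable_bounded_support (f : T -> R) : measurable_fun [set: T] f ->
  (forall p, `|f p| <= C * \1_K p) -> mu.-integrable [set: T] (EFin \o f).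
Proof.
move=> mf fC.
apply: le_integrable (integrable_scaled_indic C) => //; first exact/measurable_EFinP.
move=> p _ /=; rewrite lee_fin (le_trans (fC p))//.
exact: ler_norm.
Qed.

Hypothesis du : forall t p, `|t| < e -> derivable (u^~ p) t 1.
Hypothesis mu_ : forall t, `|t| < e -> measurable_fun [set: T] (u t).
Hypothesis u0 : forall t p, `|t| < e -> `|u t p| <= C * \1_K p.
Hypothesis u1 : forall t p, `|t| < e -> `|partial1of2 u t p| <= C * \1_K p.

Lemma parametric_integrable t : `|t| < e ->
  mu.-integrable [set: T] (EFin \o u t).
Proof. by move=> te; apply: integrable_bounded_support; [exact: mu_|move=> p; exact: u0]. Qed.

(** The difference quotients are dominated by a multiple of the indicator of [K],
    whose measure is finite. *)
Lemma parametric_derive t : `|t| < e ->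
  derivable (fun s => \int[mu]_p u s p) t 1 /\
  derive1 (fun s => \int[mu]_p u s p) t = \int[mu]_p partial1of2 u t p.
Proof.
move=> te.
have itv s : `](- e), e[%classic s -> `|s| < e by rewrite /= in_itv /= ltr_norml.
have Ia : `](- e), e[%classic t by rewrite /= in_itv /= -ltr_norml.
pose G p : R := `|C| * \1_K p.
have G0 p : 0 <= G p by rewrite mulr_ge0.
have iG : mu.-integrable [set: T] (EFin \o G) := integrable_scaled_indic `|C|.
have GC p : C * \1_K p <= G p by rewrite ler_wpM2r// ler_norm.
split.
  apply: (derivable_under_integral measurableT Ia _ _ G0 iG).
  - by move=> s /itv; exact: parametric_integrable.
  - by move=> s p /itv se _; exact: du.
  - by move=> s p /itv se _; exact: le_trans (u1 p se) (GC p).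
apply: (differentiation_under_integral measurableT Ia _ _ G0 iG).
- by move=> s /itv; exact: parametric_integrable.
- by move=> s p /itv se _; exact: du.
- by move=> s p /itv se _; exact: le_trans (u1 p se) (GC p).
Qed.

End parametric_integral.

Section second_derivative_at_minimum.
Context (R : realType).

(** Were the second derivative negative, the first one would be negative on the
    right of 0, and by the mean value theorem so would [F]. *)
Lemma minimum_second_derivative (F : R -> R) (e : R) :
  0 < e -> (forall t, 0 <= F t) -> F 0 = 0 ->
  (forall t, `|t| < e -> derivable F t 1) -> derivable (derive1 F) 0 1 ->
  is_derive (0 : R) (1 : R) F (0 : R) /\ 0 <= derive1n 2 F 0.
Proof.
move=> e0 F0 F00 dF d2F.
have D0 : is_derive (0 : R) (1 : R) F (0 : R).
  apply: (@derive1_at_min _ F (- e) e).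
  - by rewrite ge0_cp// ltW.
  - by move=> t; rewrite in_itv /= -ltr_norml; exact: dF.
  - by rewrite in_itv /= oppr_lt0 e0.
  - by move=> t _; rewrite F00.
split=> //; rewrite leNgt; apply/negP => neg.
have F'0 : derive1 F 0 = 0 by rewrite derive1E; exact: derive_val.
have neg' : 'D_1 (derive1 F) 0 < 0 by rewrite -derive1E.
have cv : (fun h : R => h^-1 *: (derive1 F (h *: (1 : R) + 0) - derive1 F 0)) @ (0 : R)^'
    --> 'D_1 (derive1 F) (0 : R) := d2F.
have [r /= r0 rP] : \forall h \near (0 : R)^',
    h^-1 *: (derive1 F (h *: (1 : R) + 0) - derive1 F 0) < 0 := cvgr_lt _ cv _ neg'.
pose h0 := Num.min r e / 2.
have m0 : 0 < Num.min r e by rewrite lt_min r0.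
have h00 : 0 < h0 by rewrite divr_gt0.
have h0m : h0 < Num.min r e by rewrite ltr_pdivrMr// ltr_pMr// ltr1n.
have small x : x \in `[0, h0] -> `|x| < r /\ `|x| < e.
  rewrite in_itv /= => /andP[x0 xh]; rewrite ger0_norm//.
  have := le_lt_trans xh h0m; rewrite lt_min => /andP[]; split => //.
have dFx x : x \in `[0, h0] -> derivable F x 1.
  by move=> /small[_ xe]; exact: dF.
have dFx' x : x \in `]0, h0[ -> is_derive x 1 F (derive1 F x).
  move=> /subset_itv_oo_cc xh; apply: DeriveDef; first exact: dFx.
  by rewrite derive1E.
have [c ch Ec] := MVT h00 dFx' (derivable_within_continuous dFx).
have [cr _] := small c (subset_itv_oo_cc ch).
have c0 : 0 < c by move: ch; rewrite in_itv => /andP[].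
have Fc : derive1 F c < 0.
  have := rP c; rewrite /ball_/= sub0r normrN => /(_ cr).
  rewrite F'0 subr0 addr0 /GRing.scale/= mulr1 gt_eqF// => /(_ isT).
  by rewrite pmulr_rlt0// invr_gt0.
have Eh : F h0 = derive1 F c * h0 by move: Ec; rewrite F00 !subr0.
have : F h0 < 0 by rewrite Eh nmulr_rlt0.
by rewrite ltNge F0.
Qed.

End second_derivative_at_minimum.

(** * The Riemannian volume of compact sets *)

Section borel_measures.
Context (R : realType) (m : nat) (M : smoothManifold R m).

Lemma open_borel (A : set (borel M)) : open (A : set M) -> measurable A.
Proof. by move=> oA; exact: sub_sigma_algebra. Qed.

Lemma continuous_borel (f : M -> R) : (forall p, {for p, continuous f}) ->
  measurable_fun [set: borel M] (f : borel M -> R).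
Proof.
move=> cf; apply: (measurability _ (RGenOpens.measurableE R)).
move=> _ [_ [a [b ->]] <-]; rewrite setTI; apply: open_borel.
by apply: open_comp => [p _|]; [exact: cf|exact: interval_open].
Qed.

Variables (g : riemannianMetric M) (vol : {measure set (borel M) -> \bar R}).
Hypothesis vol_g : riemannian_measure g vol.

(** In a chart the volume of a small coordinate cube is the integral of a
    bounded function over a bounded set. *)
Lemma volume_locally_finite (p : M) :
  exists A : set M, [/\ open A, A p & (vol A < +oo)%E].
Proof.
pose i := chart_at p; have ip : dom i p := dom_chart_at p.
pose y0 := chart_map i p; pose U := chart_map i @` dom i.
have Uy0 : U y0 by exists p.
have oU : open U by exact: open_chart_map_dom.
have cdet : {for y0, continuous (fun y => \det (g i y))}.
  by apply: (Ck_det (k := 0) oU) Uy0 => a b; exact: (metric_smooth g i a b 0).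
pose c := Num.sqrt (\det (g i y0) + 1).
have n1 : \forall y \near y0, Num.sqrt (\det (g i y)) <= c.
  have /cvgrPdist_lt /(_ 1 ltr01) := cdet; apply: filterS => y lt1.
  apply: ler_wsqrtr; rewrite addrC -lerBlDr; apply: ltW; apply: le_lt_trans lt1.
  by rewrite distrC; exact: ler_norm.
have /nbhs_ballP[r /= r0 rP] := n1.
pose A : set M := [set q | dom i q /\ ball y0 r (chart_map i q)].
have oA : open A.
  rewrite openE => q [iq Bq].
  have n2 := open_nbhs_nbhs (conj (open_dom i) iq).
  have n3 : \forall q' \near q, ball y0 r (chart_map i q').
    have nB : nbhs (chart_map i q) (ball y0 r).
      by apply: open_nbhs_nbhs; split => //; exact: ball_open.
    exact: (chart_map_continuous_on iq nB).
  exact: filterI n2 n3.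
exists A; split => //; first by split => //; exact: ballxx.
have Ai : A `<=` dom i by move=> q [].
rewrite (vol_g (open_borel oA) Ai).
set f := (fun y => _); have inA y : (chart_map i @` A) y -> ball y0 r y.
  by move=> [q [_ Bq] <-].
have := @rV_integral_box R m f y0 c r (sqrtr_ge0 _) r0.
have H1 v : (0 <= f v)%E by rewrite lee_fin mulr_ge0// sqrtr_ge0.
have H2 v : (f v <= c%:E)%E.
  rewrite lee_fin indicE; have [vA|vA] := boolP (v \in _).
    by rewrite mulr1; apply: rP; apply: inA; move: vA; rewrite inE.
  by rewrite mulr0 sqrtr_ge0.
have H3 (v : 'rV[R]_m) k : r <= `|y0 0 k - v 0 k| -> f v = 0%E.
  move=> rk; rewrite /f indicE; have [vA|vA] := boolP (v \in _); last by rewrite mulr0.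
  have : ball y0 r v by apply: inA; move: vA; rewrite inE.
  rewrite -ball_normE /ball_/= => vr; move: rk; rewrite leNgt => /negP[].
  apply: le_lt_trans vr.
  rewrite [leRHS]/Num.Def.normr/= mx_normrE.
  by apply: le_trans (le_bigmax _ _ (0, k)); rewrite !mxE.
move=> /(_ H1 H2 H3)[_ H4]; exact: le_lt_trans H4 (ltry _).
Qed.

Lemma compact_borel (K : set (borel M)) : compact (K : set M) -> measurable K.
Proof.
move=> cK; rewrite -[K]setCK; apply: measurableC; apply: open_borel.
by apply: closed_openC; exact: (compact_closed (@manifold_hausdorff _ _ M) cK).
Qed.

Lemma volume_compact (K : set M) : compact K -> (vol K < +oo)%E.
Proof.
move=> cK; have /choice[A AP] := volume_locally_finite.
have cov : K `<=` cover K A by move=> p Kp; exists p => //; have [] := AP p.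
move: (cK); rewrite compact_cover => /(_ _ _ _ (fun p _ => let: And3 o _ _ := AP p in o) cov).
move=> [D DK KD].
have fD : finite_set [set` D] by exact: finite_fset.
have mA p : [set` D] p -> measurable (A p : set (borel M)).
  by move=> _; apply: open_borel; have [] := AP p.
have le := @content_sub_fsum _ _ _ vol _ [set` D] K A fD mA (compact_borel cK) KD.
apply: le_lt_trans le _; rewrite fsbig_finite//=.
by apply: lte_sum_pinfty => p _; have [] := AP p.
Qed.

End borel_measures.

(** * Weak stability *)

Lemma near_norm_lt (R : realType) (e t : R) : `|t| < e ->
  \forall s \near t, `|s| < e.
Proof.
move=> te; have c : {for t, continuous (fun s : R => `|s|)} by exact: norm_continuous.
have ne : nbhs `|t| [set x : R | x < e].
  by apply: open_nbhs_nbhs; split => //; exact: open_lt.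
exact: (c _ ne).
Qed.

Section uniform_regularity.
Context (R : realType) (M : ptopologicalType) (u : R -> M -> R).

(** The number [C] bounds the function and its derivatives, and its inverse bounds
    the time.  Enlarging [C] weakens the claim in both respects, so the local
    constants can be combined by compactness. *)
Lemma regular_compact (K : set M) : compact K ->
  (forall p, K p -> exists C, \forall tp \near ((0 : R), p), regular u C tp.1 tp.2) ->
  exists2 C : R, 0 < C &
    forall t p, K p -> `|t| < C^-1 -> regular u C t p.
Proof.
move=> /compact_near_coveringP cK loc.
pose P (C : R) p := forall t, `|t| < C^-1 -> regular u C t p.
have nP : \forall C \near +oo, K `<=` P C.
  apply: cK => p /loc[C0 [[A B] [/= A0 Bp] AB]].
  have [r /= r0 rA] := A0.
  exists (B, [set C : R | Num.max C0 r^-1 < C]).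
    by split=> //; exact: (nbhs_pinfty_gt (num_real _)).
  move=> -[q C] /= [Bq]; rewrite gt_max => /andP[C0C rC] t tC.
  apply: (regular_le (ltW C0C)).
  apply: (AB (t, q)); split => //=; apply: rA.
  rewrite /ball_/= sub0r normrN (lt_trans tC)// invf_plt//.
    by rewrite posrE (lt_trans _ rC)// invr_gt0.
have : \forall C \near +oo, K `<=` P C /\ 0 < C.
  by apply: filterI => //; exact: (nbhs_pinfty_gt (num_real _)).
by move=> /filter_ex[C [KP C0]]; exists C => // t p Kp; exact: KP.
Qed.

(** Off the closed set [K] the value zero persists nearby in space and in time,
    so the derivatives vanish as well. *)
Lemma regular_zero (K : set M) (e : R) (t : R) (p : M) : closed K ->
  (forall s q, `|s| < e -> ~ K q -> u s q = 0) ->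
  `|t| < e -> ~ K p -> regular u 0 t p.
Proof.
move=> clK u0 te nKp.
have Z (w : R -> M -> R) : (forall s q, `|s| < e -> ~ K q -> w s q = 0) ->
    forall (s : R) q, `|s| < e -> ~ K q -> is_derive s (1 : R) (w^~ q) 0.
  move=> w0 s q se nKq; have : is_derive s (1 : R) (cst 0 : R -> R) 0 by exact: is_derive_cst.
  apply: near_eq_is_derive.
  by apply: filterS (near_norm_lt se) => x xe; rewrite w0.
have P0 (w : R -> M -> R) : (forall s q, `|s| < e -> ~ K q -> w s q = 0) ->
    forall s q, `|s| < e -> ~ K q -> partial1of2 w s q = 0.
  by move=> w0 s q se nKq; rewrite partial1of2E; apply: (@derive_val _ _ _ _ _ _ _ (Z w w0 s q se nKq)).
have C0 (w : R -> M -> R) : (forall s q, `|s| < e -> ~ K q -> w s q = 0) ->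
    {for p, continuous (w t)}.
  move=> w0; change (w t q @[q --> p] --> w t p); rewrite w0//.
  have nK : \forall q \near p, ~ K q.
    exact: (open_nbhs_nbhs (conj (closed_openC clK) nKp)).
  have nw : \forall q \near p, (fun=> 0 : R) q = w t q.
    by apply: filterS nK => q nKq; rewrite w0.
  exact: (cvg_trans (near_eq_cvg nw) (cvg_cst (0 : R))).
have u10 := P0 _ u0; have u20 := P0 _ u10.
split.
- exact: (@ex_derive _ _ _ _ _ _ _ (Z _ u0 t p te nKp)).
- exact: (@ex_derive _ _ _ _ _ _ _ (Z _ u10 t p te nKp)).
- by rewrite u0// u10// u20// normr0.
- exact: C0.
- exact: C0.
Qed.

End uniform_regularity.

Section energy.
Context (R : realType) (m n : nat).
Variables (M : smoothManifold R m) (N : smoothManifold R n).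
Variables (g : riemannianMetric M) (h : riemannianMetric N).
Variables (vol : {measure set (borel M) -> \bar R}).
Hypothesis vol_g : riemannian_measure g vol.
Variables (phi : M -> N) (V : M -> 'rV[R]_n) (Phi : R -> M -> N).
Hypotheses (harmonic_phi : harmonic_map g h phi).
Hypothesis var : smooth_variation phi V Phi.

Let u : R -> M -> R := density_along g h Phi.

(** On the support of the variation the bound comes from compactness; elsewhere
    the density is zero, as the variation locally agrees with a harmonic map. *)
Lemma density_along_regular : exists K : set M, exists C : R, exists2 e : R, 0 < e &
  compact K /\ forall t p, `|t| < e -> regular u (C * \1_K p) t p.
Proof.
case: var => Phi0 _ [e e0 [cPhi sPhi [K cK offK]]].
have clK : closed K := compact_closed (@manifold_hausdorff _ _ M) cK.
have u0 s q : `|s| < e -> ~ K q -> u s q = 0.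
  move=> se nKq; apply: ES4_density_eq0; rewrite -(harmonic_phi q).
  apply: tension_field_near.
  have nK := open_nbhs_nbhs (conj (closed_openC clK) nKq).
  by apply: filterS nK => q' nKq'; exact: offK.
have loc p : K p -> exists C, \forall tp \near ((0 : R), p), regular u C tp.1 tp.2.
  by move=> _; exact: (density_regular_near g h e0 cPhi sPhi).
have [C C0 regC] := regular_compact cK loc.
exists K, C, (Num.min e C^-1); first by rewrite lt_min e0 invr_gt0.
split => // t p; rewrite lt_min => /andP[te tC]; rewrite indicE.
have [pK|pK] := boolP (p \in K).
  by rewrite mulr1; apply: regC => //; move: pK; rewrite inE.
rewrite mulr0; apply: (regular_zero clK u0 te).
by move: pK; rewrite notin_setE.
Qed.

(** [parametric_derive] is applied to the density and to its time derivative.  The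
    energy is nonnegative, and zero at time 0 by harmonicity. *)
Lemma energy_along_regular : [/\
  \forall t \near (0 : R), ES4_energy g h vol (Phi t) \is a fin_num,
  \forall t \near (0 : R), derivable (energy_along g h vol Phi) t 1,
  is_derive (0 : R) (1 : R) (energy_along g h vol Phi) (0 : R),
  derivable (derive1 (energy_along g h vol Phi)) 0 1 &
  0 <= derive1n 2 (energy_along g h vol Phi) 0].
Proof.
have [K [C [e e0 [cK reg]]]] := density_along_regular.
have mK := compact_borel cK; have vK := volume_compact vol_g cK.
pose u1 := partial1of2 u.
have mu0 t : `|t| < e -> measurable_fun [set: borel M] (u t : borel M -> R).
  by move=> te; apply: continuous_borel => p; case: (reg t p te).
have mu1 t : `|t| < e -> measurable_fun [set: borel M] (u1 t : borel M -> R).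
  by move=> te; apply: continuous_borel => p; case: (reg t p te).
have du0 t p : `|t| < e -> derivable (u^~ p) t 1.
  by move=> /(reg t p)[+ _ _ _ _]; exact.
have du1 t p : `|t| < e -> derivable (u1^~ p) t 1.
  by move=> /(reg t p)[_ + _ _ _]; exact.
have b0 t p : `|t| < e -> `|u t p| <= C * \1_K p by move=> /(reg t p)[_ _ []].
have b1 t p : `|t| < e -> `|u1 t p| <= C * \1_K p by move=> /(reg t p)[_ _ []].
have b2 t p : `|t| < e -> `|partial1of2 u1 t p| <= C * \1_K p.
  by move=> /(reg t p)[_ _ []].
pose F t := (\int[vol]_p (u t p)).
pose F1 t := (\int[vol]_p (u1 t p)).
have int t te := parametric_integrable mK vK mu0 b0 (t := t) te.
have dF t (te : `|t| < e) := parametric_derive mK vK du0 mu0 b0 b1 te.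
have e00 : `|0 : R| < e by rewrite normr0.
have [dF1 _] := parametric_derive mK vK du1 mu1 b1 b2 e00.
have finI t : `|t| < e -> (\int[vol]_(p in [set: borel M]) (u t p)%:E \is a fin_num)%E.
  by move=> te; exact: (integrable_fin_num measurableT (int t te)).
have EF t : `|t| < e -> energy_along g h vol Phi t = 4^-1 * F t.
  by move=> te; rewrite /energy_along /ES4_energy fineM// finI.
have near_e := near_norm_lt e00.
have nearEF t : `|t| < e -> \forall s \near t, 4^-1 * F s = energy_along g h vol Phi s.
  by move=> te; apply: filterS (near_norm_lt te) => s se; rewrite EF.
have DE (t : R) : `|t| < e -> is_derive t (1 : R) (energy_along g h vol Phi) (4^-1 * F1 t).
  move=> te; apply: near_eq_is_derive (nearEF t te) _.
  have [d1 d2] := dF t te; apply: DeriveDef.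
    exact: (@derivableM _ _ (cst 4^-1) F t 1 (derivable_cst _ _ _) d1).
  rewrite derive_funMl; last exact/derivable1_diffP.
  by rewrite -derive1E d2.
have E0 : energy_along g h vol Phi 0 = 0.
  rewrite EF// /F /Rintegral integral0_eq ?mulr0// => p _.
  congr (_%:E); apply: ES4_density_eq0.
  by case: var => -> _ _; exact: harmonic_phi.
have Ege0 t : 0 <= energy_along g h vol Phi t.
  rewrite fine_ge0// mule_ge0// ?lee_fin// integral_ge0// => p _.
  by rewrite lee_fin; exact: ES4_density_ge0.
have D2 : derivable (derive1 (energy_along g h vol Phi)) 0 1.
  have : derivable (fun t => 4^-1 * F1 t) (0 : R) (1 : R).
    exact: (@derivableM _ _ (cst 4^-1) F1 0 1 (derivable_cst _ _ _) dF1).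
  apply: near_eq_derivable; apply: filterS near_e => t te.
  by rewrite derive1E; apply: esym; exact: (@derive_val _ _ _ _ _ _ _ (DE t te)).
have dE (t : R) : `|t| < e -> derivable (energy_along g h vol Phi) t (1 : R).
  by move=> te; exact: (@ex_derive _ _ _ _ _ _ _ (DE t te)).
have [D1 D2ge0] := minimum_second_derivative e0 Ege0 E0 dE D2.
split => //.
- apply: filterS near_e => t te.
  by rewrite /ES4_energy fin_numM// finI.
- by apply: filterS near_e => t te; exact: dE.
Qed.

End energy.

Theorem theorem4p2 (R : realType) (m n : nat)
  (M : smoothManifold R m) (N : smoothManifold R n)
  (g : riemannianMetric M) (h : riemannianMetric N)
  (vol : {measure set (borel M) -> \bar R}) (vol_g : riemannian_measure g vol)
  (phi : M -> N) (smooth_phi : smooth_map phi) (harmonic_phi : harmonic_map g h phi) :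
  weakly_stable g h vol phi.
Proof.
split=> [V Phi var|V Phi _ var].
  by have [] := energy_along_regular vol_g harmonic_phi var.
by have [] := energy_along_regular vol_g harmonic_phi var.
Qed.
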